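(* Let $g$ be a non-constant power series with non-negative coefficients and radius of convergence $R>0$, and let $f=e^g$, with fulcrum $F(s)=\ln f(e^s)=g(e^s)$ for real $s<\ln R$. Assume that $g$ is a clan and that $\lim_{t\uparrow R}g(t)=+\infty$. Then $$\lim_{s\uparrow\ln R}\frac{F^{(k)}(s)}{F''(s)^{k/2}}=0\quad\text{for every integer }k\ge3,$$ for every integer $m\ge1$ one has $\lim_{t\uparrow R}\mathbf{E}(\breve{X}_t^m)=\mathbf{E}(Z^m)$ where $Z$ is a standard normal random variable, and $f$ is Gaussian.
   Context: The class $\mathcal{K}$ consists of non-constant power series $h(z)=\sum_{n\ge0}a_nz^n$ with radius of convergence $R\in(0,+\infty]$, with $a_n\ge 0$ for all $n$ and $a_0>0$. For $h\in\mathcal{K}$ and $t\in(0,R)$, its Khinchin family consists of the random variables $X_t$ with $\mathbf{P}(X_t=n)=a_nt^n/h(t)$, $n\ge0$; $m_h(t)=\mathbf{E}(X_t)=th'(t)/h(t)$, $\sigma_h^2(t)=\mathbf{V}(X_t)=t\,m_h'(t)$, and $\breve{X}_t=(X_t-m_h(t))/\sigma_h(t)$. A power series $h\in\mathcal{K}$ is called a clan if $\lim_{t\uparrow R}\sigma_h(t)/m_h(t)=0$. Here $f=e^g\in\mathcal{K}$, $(X_t)$ denotes the Khinchin family of $f$, and $f$ is called Gaussian if $\breve{X}_t$ converges in distribution to a standard normal random variable as $t\uparrow R$ ($t\to+\infty$ if $R=+\infty$). *)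

(* Defs.v *)
From Stdlib Require Import Reals.
From Coquelicot Require Import Coquelicot.
Open Scope R_scope.

Definition psum (a : nat -> R) (t : R) : R := PSeries a t.

Definition mean_h (a : nat -> R) (t : R) : R :=
  t * Derive (psum a) t / psum a t.
Definition var_h (a : nat -> R) (t : R) : R :=
  t * Derive (mean_h a) t.
Definition sd_h (a : nat -> R) (t : R) : R := sqrt (var_h a t).

Definition up_to (Rc : Rbar) : (R -> Prop) -> Prop :=
  match Rc with
  | Finite r => at_left r
  | p_infty => Rbar_locally p_infty
  | m_infty => Rbar_locally m_infty (* never used: R > 0 *)
  end.

Definition up_to_ln (Rc : Rbar) : (R -> Prop) -> Prop :=
  match Rc with
  | Finite r => at_left (ln r)
  | p_infty => Rbar_locally p_infty
  | m_infty => Rbar_locally m_infty (* never used: R > 0 *)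
  end.

Definition is_clan (a : nat -> R) : Prop :=
  filterlim (fun t => sd_h a t / mean_h a t) (up_to (CV_radius a)) (locally 0).

(* Fulcrum of f = e^g:  F(s) = ln f(e^s) = g(e^s). *)
Definition fulcrum (b : nat -> R) (s : R) : R := psum b (exp s).

Definition khin_prob (a : nat -> R) (t : R) (n : nat) : R :=
  a n * t ^ n / psum a t.

Definition normalized (a : nat -> R) (t : R) (n : nat) : R :=
  (INR n - mean_h a t) / sd_h a t.

Definition khin_moment (a : nat -> R) (t : R) (m : nat) : R :=
  Series (fun n => (normalized a t n) ^ m * khin_prob a t n).

Definition khin_cdf (a : nat -> R) (t : R) (x : R) : R :=
  Series (fun n => if Rle_dec (normalized a t n) x then khin_prob a t n else 0).

Definition std_normal_density (u : R) : R := exp (- (u ^ 2) / 2) / sqrt (2 * PI).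
Definition std_normal_moment (m : nat) : R :=
  RInt_gen (fun u => u ^ m * std_normal_density u)
           (Rbar_locally m_infty) (Rbar_locally p_infty).
Definition std_normal_cdf (x : R) : R :=
  RInt_gen std_normal_density (Rbar_locally m_infty) (at_point x).

(* h is Gaussian: Xbreve_t converges in distribution to N(0,1) as t -> R^-,
   i.e. (the limit distribution function being continuous) pointwise
   convergence of the distribution functions at every x. *)
Definition is_gaussian (a : nat -> R) : Prop :=
  forall x : R,
    filterlim (fun t => khin_cdf a t x) (up_to (CV_radius a)) (locally (std_normal_cdf x)).

(* Main.v *)
Require Import Defs.
From Stdlib Require Import Reals Factorial Lra Lia.
From Coquelicot Require Import Coquelicot.
Open Scope R_scope.

(** With E_k(t) = sum_n n^k b_n t^n one has F^(k)(s) = E_k(e^s), so the claim on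
    F is a comparison of E_k with E_2^(k/2).  The clan condition says that
    (E_0/E_1)' = 1 - E_0 E_2 / E_1^2 tends to 0 (derivatives in s); hence
    (ln E_0)' = E_1/E_0 at most doubles on [s, s + E_0/E_1], and
    E_0(s + E_0/E_1) <= e^2 E_0(s).  Comparing n^k with
    k! (E_1/E_0)^k exp(n E_0/E_1) gives E_k <= k! e^2 (E_1/E_0)^k E_0, and with
    E_2 >= E_1^2 / E_0 the quotient E_k / E_2^(k/2) is O(E_0^(1 - k/2)).

    The recursion n a_n = sum_k k b_k a_(n-k) is the size-bias identity
    E[X phi(X)] = sum_k k b_k t^k E[phi(X + k)].  For phi a power of the
    normalized variable it is the moment-cumulant recursion, whose limit is
    the recursion of the normal moments.  For a general phi it gives Stein's
    bound |E[W phi(W) - phi'(W)]| <= sup|phi''| E_3 / E_2^(3/2), from which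
    convergence of the distribution functions follows by solving Stein's equation
    for smoothed indicators. *)

(** * Moment series and the filter of approach to the radius *)

(* Coquelicot often leaves equations at the carrier of a [NormedModule]. *)
Ltac real_eq := match goal with |- @eq _ ?x ?y => change (@eq R x y) end.

(** The clan hypothesis concerns the Khinchin family of g, the conclusions that of f. The bridge is
    that X_t is compound Poisson: for k >= 1, E_k(t) is its k-th cumulant, so E_1 and E_2 are its
    mean and variance and F^(k)/F''^(k/2) is a cumulant of the normalized variable. E_0 = g acts as
    a sample size, whence normality from its divergence and the threshold k >= 3 in E_0^(1 - k/2).
    Two obstacles shape the argument. When R is finite, the shifted point s + E_0/E_1 might leave
    the domain; the growth estimate itself excludes this, since it would keep g bounded up to R. And
    f is known only through f = e^g on [0, R): that its radius is exactly R and its coefficients are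
    non-negative must be derived before X_t can be treated as a random variable. Normality is not
    drawn from the moment limits, which would require that the normal law is determined by its
    moments together with a compactness argument. Stein's bound is quantitative and involves the
    third cumulant alone. *)

Lemma is_series_Rmult (c : R) (u : nat -> R) (l : R) :
  is_series u l -> is_series (fun n => c * u n) (c * l).
Proof. exact (is_series_scal c u l). Qed.

Lemma is_series_Rminus (u v : nat -> R) (l m : R) :
  is_series u l -> is_series v m -> is_series (fun n => u n - v n) (l - m).
Proof. exact (is_series_minus u v l m). Qed.

Lemma is_series_Ropp (u : nat -> R) (l : R) :
  is_series u l -> is_series (fun n => - u n) (- l).
Proof. exact (is_series_opp u l). Qed.

Lemma is_series_Rplus (u v : nat -> R) (l m : R) :
  is_series u l -> is_series v m -> is_series (fun n => u n + v n) (l + m).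
Proof. exact (is_series_plus u v l m). Qed.

Lemma exp_le (x y : R) : x <= y -> exp x <= exp y.
Proof. intros [H| ->]; [left; now apply exp_increasing|lra]. Qed.

(** This is E_k, the operator t d/dt applied k times to g. Since [0 ^ 0 = 1], the constant term of g
    is counted for k = 0. *)
Definition pmom (b : nat -> R) (k : nat) (t : R) : R :=
  PSeries (fun n => INR n ^ k * b n) t.

(** For k >= 2, the k-th cumulant of the normalized variable. Natural powers of the standard
    deviation keep the algebra polynomial. *)
Definition ncumulant (b : nat -> R) (k : nat) (t : R) : R :=
  pmom b k t / sqrt (pmom b 2 t) ^ k.

(** Multiplying coefficients by n is the operator t d/dt, a shifted formal derivative. Radius and
    derivative of [pmom] are both read off from this form. *)
Lemma euler_coef (c : nat -> R) (n : nat) :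
  PS_incr_1 (PS_derive c) n = INR n * c n.
Proof. destruct n; unfold PS_incr_1, PS_derive; cbn -[INR]; simpl (INR 0); ring_simplify; reflexivity. Qed.

Lemma pmom_coef_succ (b : nat -> R) (k n : nat) :
  INR n ^ S k * b n = PS_incr_1 (PS_derive (fun n => INR n ^ k * b n)) n.
Proof. rewrite euler_coef; simpl; ring. Qed.

Lemma CV_radius_pmom (b : nat -> R) (k : nat) :
  CV_radius (fun n => INR n ^ k * b n) = CV_radius b.
Proof.
  induction k as [|k IH].
  - apply CV_radius_ext; intros n; simpl; ring.
  - rewrite (CV_radius_ext _ _ (pmom_coef_succ b k)).
    now rewrite CV_radius_incr_1, CV_radius_derive.
Qed.

Lemma pmom_0 (b : nat -> R) (t : R) : pmom b 0 t = PSeries b t.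
Proof. apply PSeries_ext; intros n; simpl; ring. Qed.

Lemma is_derive_pmom (b : nat -> R) (k : nat) (t : R) :
  t <> 0 -> Rbar_lt (Rabs t) (CV_radius b) ->
  is_derive (pmom b k) t (pmom b (S k) t / t).
Proof.
  intros Ht Hr.
  replace (pmom b (S k) t / t) with (PSeries (PS_derive (fun n => INR n ^ k * b n)) t).
  - apply is_derive_PSeries; now rewrite CV_radius_pmom.
  - unfold pmom. rewrite (PSeries_ext _ _ t (pmom_coef_succ b k)), PSeries_incr_1.
    now field.
Qed.

Lemma is_derive_pmom_exp (b : nat -> R) (k : nat) (s : R) :
  Rbar_lt (exp s) (CV_radius b) ->
  is_derive (fun s => pmom b k (exp s)) s (pmom b (S k) (exp s)).
Proof.
  intros Hr. pose proof (exp_pos s).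
  replace (pmom b (S k) (exp s)) with (scal (exp s) (pmom b (S k) (exp s) / exp s)).
  - apply (is_derive_comp (pmom b k) exp).
    + apply is_derive_pmom; [lra|]. now rewrite Rabs_pos_eq by lra.
    + apply is_derive_exp.
  - unfold scal; simpl; unfold mult; simpl; field; lra.
Qed.

Lemma ex_series_pmom (b : nat -> R) (k : nat) (t : R) :
  0 <= t -> Rbar_lt t (CV_radius b) ->
  ex_series (fun n => INR n ^ k * b n * t ^ n).
Proof.
  intros Ht Hr. apply (ex_pseries_R (fun n => INR n ^ k * b n)), CV_radius_inside.
  now rewrite CV_radius_pmom, Rabs_pos_eq.
Qed.

Lemma is_series_pmom (b : nat -> R) (k : nat) (t : R) :
  0 <= t -> Rbar_lt t (CV_radius b) ->
  is_series (fun n => INR n ^ k * b n * t ^ n) (pmom b k t).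
Proof. intros Ht Hr. now apply Series_correct, ex_series_pmom. Qed.

Lemma is_series_nonneg (u : nat -> R) (l : R) :
  (forall n, 0 <= u n) -> is_series u l -> 0 <= l.
Proof.
  intros Hu Hl.
  apply (is_lim_seq_le (fun _ => 0) (sum_n u) 0 l); [|apply is_lim_seq_const|exact Hl].
  intros n. rewrite sum_n_Reals. apply cond_pos_sum, Hu.
Qed.

Lemma is_series_le (u v : nat -> R) (l m : R) :
  (forall n, u n <= v n) -> is_series u l -> is_series v m -> l <= m.
Proof.
  intros H Hu Hv.
  cut (0 <= m - l); [lra|].
  apply (is_series_nonneg (fun n => v n - u n)).
  - intros n; specialize (H n); lra.
  - exact (is_series_minus v u m l Hv Hu).
Qed.

Lemma is_series_term_le (u : nat -> R) (l : R) (n : nat) :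
  (forall n, 0 <= u n) -> is_series u l -> u n <= l.
Proof.
  intros Hu Hl.
  apply Rle_trans with (sum_n u n).
  - destruct n; [rewrite sum_O; lra|]. rewrite sum_Sn, sum_n_Reals.
    unfold plus; simpl. pose proof (cond_pos_sum u n Hu). lra.
  - apply (is_lim_seq_incr_compare (sum_n u) l Hl).
    intros k. rewrite sum_Sn. unfold plus; simpl. specialize (Hu (S k)); lra.
Qed.

Section NonnegativeSeries.

Variable b : nat -> R.
Hypothesis b_ge0 : forall n, 0 <= b n.
Hypothesis b_nonconstant : exists n, (1 <= n)%nat /\ 0 < b n.

Lemma pmom_term_ge0 (k : nat) (t : R) (n : nat) :
  0 <= t -> 0 <= INR n ^ k * b n * t ^ n.
Proof.
  intros Ht. apply Rmult_le_pos; [apply Rmult_le_pos|]; auto using pow_le, pos_INR.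
Qed.

Lemma pmom_gt0 (k : nat) (t : R) :
  0 < t -> Rbar_lt t (CV_radius b) -> 0 < pmom b k t.
Proof.
  intros Ht Hr. destruct b_nonconstant as [n [Hn Hb]].
  apply Rlt_le_trans with (INR n ^ k * b n * t ^ n).
  - apply Rmult_lt_0_compat; [apply Rmult_lt_0_compat|]; auto using pow_lt.
    apply pow_lt, lt_0_INR; lia.
  - apply (is_series_term_le _ _ n (fun n => pmom_term_ge0 k t n (Rlt_le _ _ Ht))).
    apply is_series_pmom; [lra|exact Hr].
Qed.

(** The series of b_n t^n (n E_0 - E_1)^2 has non-negative terms and sums to E_0 (E_0 E_2 -
    E_1^2). *)
Lemma pmom_cauchy_schwarz (t : R) :
  0 < t -> Rbar_lt t (CV_radius b) ->
  pmom b 1 t ^ 2 <= pmom b 0 t * pmom b 2 t.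
Proof.
  intros Ht Hr.
  pose proof (pmom_gt0 0 t Ht Hr) as H0.
  set (e0 := pmom b 0 t) in *. set (e1 := pmom b 1 t). set (e2 := pmom b 2 t).
  assert (H : 0 <= e0 ^ 2 * e2 - 2 * e0 * e1 * e1 + e1 ^ 2 * e0).
  { apply (is_series_nonneg (fun n => b n * t ^ n * (INR n * e0 - e1) ^ 2)).
    - intros n. apply Rmult_le_pos; [|apply pow2_ge_0].
      apply Rmult_le_pos; [apply b_ge0|apply pow_le; lra].
    - pose proof (is_series_pmom b 0 t (Rlt_le _ _ Ht) Hr) as S0.
      pose proof (is_series_pmom b 1 t (Rlt_le _ _ Ht) Hr) as S1.
      pose proof (is_series_pmom b 2 t (Rlt_le _ _ Ht) Hr) as S2.
      apply (is_series_scal_r (e0 ^ 2)) in S2.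
      apply (is_series_scal_r (2 * e0 * e1)) in S1.
      apply (is_series_scal_r (e1 ^ 2)) in S0.
      pose proof (is_series_plus _ _ _ _ (is_series_minus _ _ _ _ S2 S1) S0) as S.
      fold e0 e1 e2 in S.
      replace (e0 ^ 2 * e2 - 2 * e0 * e1 * e1 + e1 ^ 2 * e0)
        with (plus (plus (e2 * e0 ^ 2) (opp (e1 * (2 * e0 * e1)))) (e0 * e1 ^ 2))
        by (unfold plus, opp; simpl; ring).
      revert S. apply is_series_ext. intros n. unfold plus, opp; simpl; ring. }
  apply Rmult_le_reg_l with e0; [exact H0|]. nra.
Qed.

End NonnegativeSeries.

(** Turns eventual statements into statements on an interval (t0, R), with the same shape for finite
    and infinite R. *)
Lemma up_to_exists (Rc : Rbar) (P : R -> Prop) :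
  Rbar_lt 0 Rc ->
  (up_to Rc P <-> exists t0, 0 < t0 /\ Rbar_lt t0 Rc /\
                   forall t, t0 < t -> Rbar_lt t Rc -> P t).
Proof.
  intros HR. destruct Rc as [r| |]; simpl in *; [| |easy].
  - split.
    + intros [e He]. exists (Rmax (r / 2) (r - e)).
      pose proof (cond_pos e). split; [|split].
      * apply Rlt_le_trans with (r / 2); [lra|apply Rmax_l].
      * apply Rmax_lub_lt; lra.
      * intros t Ht Htr. apply He; [|exact Htr].
        unfold ball; simpl; unfold AbsRing_ball, abs, minus, plus, opp; simpl.
        pose proof (Rmax_r (r / 2) (r - e)). apply Rabs_def1; lra.
    + intros [t0 [H0 [H1 H2]]].
      assert (He : 0 < r - t0) by lra. exists (mkposreal _ He). simpl.
      intros t Hb Ht. apply H2; [|exact Ht].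
      unfold ball in Hb; simpl in Hb; unfold AbsRing_ball, abs, minus, plus, opp in Hb; simpl in Hb.
      apply Rabs_def2 in Hb. lra.
  - split.
    + intros [M HM]. exists (Rmax 1 M). split; [|split; [exact I|]].
      * apply Rlt_le_trans with 1; [lra|apply Rmax_l].
      * intros t Ht _. apply HM. pose proof (Rmax_r 1 M). lra.
    + intros [t0 [H0 [_ H2]]]. exists t0. intros t Ht. now apply H2.
Qed.

Lemma filterlim_exp_up_to (Rc : Rbar) :
  Rbar_lt 0 Rc -> filterlim exp (up_to_ln Rc) (up_to Rc).
Proof.
  intros HR P HP. apply (up_to_exists Rc P HR) in HP.
  destruct HP as [t0 [H0 [H1 H2]]]. unfold filtermap.
  destruct Rc as [r| |]; simpl in *; [| |easy].
  - assert (He : 0 < ln r - ln t0) by (apply Rlt_0_minus, ln_increasing; lra).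
    exists (mkposreal _ He). simpl. intros s Hb Hs.
    unfold ball in Hb; simpl in Hb; unfold AbsRing_ball, abs, minus, plus, opp in Hb; simpl in Hb.
    apply Rabs_def2 in Hb. apply H2.
    + rewrite <- (exp_ln t0) by lra. apply exp_increasing; lra.
    + rewrite <- (exp_ln r) by lra. now apply exp_increasing.
  - exists (ln t0). intros s Hs. apply H2; [|exact I].
    rewrite <- (exp_ln t0) by lra. now apply exp_increasing.
Qed.

Lemma up_to_filter (Rc : Rbar) : Rbar_lt 0 Rc -> ProperFilter (up_to Rc).
Proof.
  destruct Rc as [r| |]; simpl; intros H; [| |easy].
  - apply at_left_proper_filter.
  - apply (Rbar_locally_filter p_infty).
Qed.

Lemma up_to_ln_filter (Rc : Rbar) : ProperFilter (up_to_ln Rc).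
Proof.
  destruct Rc as [r| |]; simpl.
  - apply at_left_proper_filter.
  - apply (Rbar_locally_filter p_infty).
  - apply (Rbar_locally_filter m_infty).
Qed.

(** * Moment bounds for clans *)

Lemma locally_inside (Rc : Rbar) (t : R) :
  0 < t -> Rbar_lt t Rc -> locally t (fun x : R => 0 < x /\ Rbar_lt x Rc).
Proof.
  intros Ht Hr. apply filter_and.
  - exact (open_gt 0 t Ht).
  - exact (open_Rbar_lt' t Rc Hr).
Qed.

Lemma mean_h_eq (a : nat -> R) (t : R) :
  0 < t -> Rbar_lt t (CV_radius a) -> mean_h a t = pmom a 1 t / pmom a 0 t.
Proof.
  intros Ht Hr. unfold mean_h. rewrite <- (pmom_0 a t : _ = psum a t).
  replace (Derive (psum a) t) with (pmom a 1 t / t).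
  - f_equal. field. lra.
  - symmetry. apply is_derive_unique.
    apply (is_derive_ext (pmom a 0)).
    + intros x. apply pmom_0.
    + apply is_derive_pmom; [lra|now rewrite Rabs_pos_eq by lra].
Qed.

Lemma var_h_eq (a : nat -> R) (t : R) :
  0 < t -> Rbar_lt t (CV_radius a) -> pmom a 0 t <> 0 ->
  var_h a t = (pmom a 2 t * pmom a 0 t - pmom a 1 t ^ 2) / pmom a 0 t ^ 2.
Proof.
  intros Ht Hr H0. unfold var_h.
  assert (Hd : forall k, is_derive (pmom a k) t (pmom a (S k) t / t)).
  { intros k. apply is_derive_pmom; [lra|now rewrite Rabs_pos_eq by lra]. }
  replace (Derive (mean_h a) t) with
    ((pmom a 2 t / t * pmom a 0 t - pmom a 1 t * (pmom a 1 t / t)) / pmom a 0 t ^ 2).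
  - field. split; [exact H0|lra].
  - symmetry. apply is_derive_unique.
    apply (is_derive_ext_loc (fun t => pmom a 1 t / pmom a 0 t)).
    + apply (filter_imp _ _ (fun x H => eq_sym (mean_h_eq a x (proj1 H) (proj2 H)))).
      now apply locally_inside.
    + now apply is_derive_div.
Qed.

Lemma mvt_le (f df : R -> R) (x y c : R) :
  x <= y -> (forall z, x <= z <= y -> is_derive f z (df z)) ->
  (forall z, x <= z <= y -> df z <= c) -> f y - f x <= c * (y - x).
Proof.
  intros Hxy Hd Hc.
  destruct (MVT_gen f x y df) as [z [Hz Heq]].
  - intros z Hz. apply Hd. rewrite Rmin_left, Rmax_right in Hz by lra. lra.
  - intros z Hz. rewrite Rmin_left, Rmax_right in Hz by lra.
    apply continuity_pt_filterlim, (ex_derive_continuous f). eexists. now apply Hd.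
  - rewrite Rmin_left, Rmax_right in Hz by lra. rewrite Heq.
    apply Rmult_le_compat_r; [lra|now apply Hc].
Qed.

Lemma mvt_ge (f df : R -> R) (x y c : R) :
  x <= y -> (forall z, x <= z <= y -> is_derive f z (df z)) ->
  (forall z, x <= z <= y -> c <= df z) -> c * (y - x) <= f y - f x.
Proof.
  intros Hxy Hd Hc.
  pose proof (mvt_le (fun z => - f z) (fun z => - df z) x y (- c) Hxy) as H.
  cbv beta in H. cut (- f y - - f x <= - c * (y - x)); [lra|]. apply H.
  - intros z Hz. now apply (is_derive_opp f z (df z)), Hd.
  - intros z Hz. now apply Ropp_le_contravar, Hc.
Qed.

Lemma pow_div_fact_le_exp (k : nat) (x : R) : 0 <= x -> x ^ k <= INR (fact k) * exp x.
Proof.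
  intros Hx.
  assert (H : / INR (fact k) * x ^ k <= exp x).
  { apply (is_series_term_le (fun k => / INR (fact k) * x ^ k)).
    - intros n. apply Rmult_le_pos; [|now apply pow_le].
      apply Rlt_le, Rinv_0_lt_compat, INR_fact_lt_0.
    - apply is_pseries_R, is_exp_Reals. }
  apply Rmult_le_reg_l with (/ INR (fact k)); [apply Rinv_0_lt_compat, INR_fact_lt_0|].
  rewrite <- Rmult_assoc, Rinv_l by apply INR_fact_neq_0. lra.
Qed.

Section Clan.

Variable b : nat -> R.
Hypothesis b_ge0 : forall n, 0 <= b n.
Hypothesis b_nonconstant : exists n, (1 <= n)%nat /\ 0 < b n.
Hypothesis radius_gt0 : Rbar_lt 0 (CV_radius b).
Hypothesis b_clan : is_clan b.
Hypothesis b_unbounded : filterlim (psum b) (up_to (CV_radius b)) (Rbar_locally p_infty).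

Let pos k t := pmom_gt0 b b_ge0 b_nonconstant k t.

(** The square of [sd_h / mean_h] is E_0 E_2 / E_1^2 - 1. A ratio below 1/2 gives the factor 5/4,
    hence 3/2, the value that makes the derivative of E_0/E_1 at least -1/2. *)
Lemma clan_second_moment :
  exists t0, 0 < t0 /\ Rbar_lt t0 (CV_radius b) /\
    forall t, t0 < t -> Rbar_lt t (CV_radius b) ->
      pmom b 0 t * pmom b 2 t <= 3 / 2 * pmom b 1 t ^ 2.
Proof.
  assert (Hh : 0 < 1 / 2) by lra.
  pose proof (b_clan _ (locally_ball 0 (mkposreal _ Hh))) as H.
  apply up_to_exists in H; [|exact radius_gt0].
  destruct H as [t0 [H0 [H1 H2]]]. exists t0. split; [exact H0|split; [exact H1|]].
  intros t Ht Hr. assert (H0t : 0 < t) by lra.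
  specialize (H2 t Ht Hr).
  unfold ball in H2; simpl in H2; unfold AbsRing_ball, abs, minus, plus, opp in H2; simpl in H2.
  unfold sd_h in H2. pose proof (pos 0 t H0t Hr) as P0. pose proof (pos 1 t H0t Hr) as P1.
  rewrite mean_h_eq, var_h_eq in H2; try lra; auto.
  pose proof (pmom_cauchy_schwarz b b_ge0 b_nonconstant t H0t Hr) as CS.
  revert H2 P0 P1 CS.
  set (e0 := pmom b 0 t). set (e1 := pmom b 1 t). set (e2 := pmom b 2 t). intros H2 P0 P1 CS.
  assert (Hv : 0 <= (e2 * e0 - e1 ^ 2) / e0 ^ 2).
  { apply Rdiv_le_0_compat; [lra|apply pow_lt, P0]. }
  apply Rabs_def2 in H2. destruct H2 as [H2 _].
  set (q := sqrt ((e2 * e0 - e1 ^ 2) / e0 ^ 2)) in *.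
  assert (Hq : 0 <= q) by apply sqrt_pos.
  assert (Hqq : q * q * e0 ^ 2 = e2 * e0 - e1 ^ 2).
  { unfold q. rewrite sqrt_sqrt by exact Hv. field. lra. }
  assert (Hlt : q * e0 < e1 / 2).
  { assert (q / (e1 / e0) = q * e0 / e1) as E by (field; lra).
    rewrite E in H2. apply Rmult_lt_reg_r with (/ e1); [now apply Rinv_0_lt_compat|].
    replace (e1 / 2 * / e1) with (1 / 2) by (field; lra). unfold Rdiv in H2. lra. }
  assert (0 <= q * e0) by (apply Rmult_le_pos; lra).
  nra.
Qed.

(* (E0/E1)' = 1 - E0 E2 / E1^2 >= -1/2, so that (ln E0)' = E1/E0 at most doubles
   on [s, s + E0/E1]. *)
Lemma clan_local_growth (t0 s x : R) :
  (forall t, t0 < t -> Rbar_lt t (CV_radius b) ->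
      pmom b 0 t * pmom b 2 t <= 3 / 2 * pmom b 1 t ^ 2) ->
  t0 < exp s -> s <= x -> Rbar_lt (exp x) (CV_radius b) ->
  x <= s + pmom b 0 (exp s) / pmom b 1 (exp s) ->
  pmom b 0 (exp x) <= exp 2 * pmom b 0 (exp s).
Proof.
  intros Hclan Hs Hsx Hx Hxs.
  assert (Hin : forall z, z <= x -> Rbar_lt (exp z) (CV_radius b)).
  { intros z Hz. apply Rbar_le_lt_trans with (exp x); [|exact Hx].
    now apply exp_le. }
  assert (Hpos : forall k z, z <= x -> 0 < pmom b k (exp z)).
  { intros k z Hz. apply pos; [apply exp_pos|now apply Hin]. }
  set (r := fun z => pmom b 0 (exp z) / pmom b 1 (exp z)).
  change (x <= s + r s) in Hxs.
  assert (Hr : 0 < r s) by (apply Rdiv_lt_0_compat; now apply Hpos).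
  assert (Hry : forall y, s <= y <= x -> r s / 2 <= r y).
  { intros y Hy.
    cut (- (1 / 2) * (y - s) <= r y - r s); [lra|].
    apply mvt_ge with (df := fun z =>
      (pmom b 1 (exp z) * pmom b 1 (exp z) - pmom b 0 (exp z) * pmom b 2 (exp z))
        / pmom b 1 (exp z) ^ 2); [lra| |].
    - intros z Hz.
      apply (is_derive_div (fun z => pmom b 0 (exp z)) (fun z => pmom b 1 (exp z))).
      + apply is_derive_pmom_exp, Hin; lra.
      + apply is_derive_pmom_exp, Hin; lra.
      + apply Rgt_not_eq, Hpos; lra.
    - intros z Hz.
      assert (Hz0 : t0 < exp z).
      { now apply Rlt_le_trans with (exp s); [|apply exp_le]. }
      specialize (Hclan (exp z) Hz0 (Hin z ltac:(lra))).
      assert (Hp : 0 < pmom b 1 (exp z)) by (apply Hpos; lra).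
      apply Rmult_le_reg_r with (pmom b 1 (exp z) ^ 2); [now apply pow_lt|].
      unfold Rdiv at 2. rewrite Rmult_assoc, Rinv_l by (apply pow_nonzero; lra). lra. }
  assert (Hln : ln (pmom b 0 (exp x)) - ln (pmom b 0 (exp s)) <= 2 / r s * (x - s)).
  { apply (mvt_le (fun z => ln (pmom b 0 (exp z)))
             (fun z => pmom b 1 (exp z) * / pmom b 0 (exp z))); [exact Hsx| |].
    - intros z Hz. apply (is_derive_comp ln (fun z => pmom b 0 (exp z))).
      + apply is_derive_ln, Hpos; lra.
      + apply is_derive_pmom_exp, Hin; lra.
    - intros z Hz. specialize (Hry z Hz).
      assert (H0 : 0 < pmom b 0 (exp z)) by (apply Hpos; lra).
      assert (H1 : 0 < pmom b 1 (exp z)) by (apply Hpos; lra).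
      replace (pmom b 1 (exp z) * / pmom b 0 (exp z)) with (/ r z) by (unfold r; field; lra).
      replace (2 / r s) with (/ (r s / 2)) by (field; lra).
      apply Rinv_le_contravar; [lra|exact Hry]. }
  assert (H2 : 2 / r s * (x - s) <= 2).
  { replace 2 with (2 / r s * r s) at 2 by (field; lra).
    apply Rmult_le_compat_l; [apply Rlt_le, Rdiv_lt_0_compat; lra|lra]. }
  rewrite <- (exp_ln (pmom b 0 (exp x))), <- (exp_ln (pmom b 0 (exp s))) by (apply Hpos; lra).
  rewrite <- exp_plus. apply exp_le. lra.
Qed.

Lemma clan_growth :
  exists t0, 0 < t0 /\ Rbar_lt t0 (CV_radius b) /\
    forall s, t0 < exp s -> Rbar_lt (exp s) (CV_radius b) ->
      Rbar_lt (exp (s + pmom b 0 (exp s) / pmom b 1 (exp s))) (CV_radius b) /\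
      pmom b 0 (exp (s + pmom b 0 (exp s) / pmom b 1 (exp s))) <= exp 2 * pmom b 0 (exp s).
Proof.
  destruct clan_second_moment as [t0 [H0 [H1 H2]]].
  exists t0. split; [exact H0|split; [exact H1|]]. intros s Hs Hr.
  set (y := pmom b 0 (exp s) / pmom b 1 (exp s)).
  assert (Hy : 0 < y).
  { apply Rdiv_lt_0_compat; apply pos; auto using exp_pos. }
  (* If s + y reached ln R, local growth would apply on all of [s, ln R) and bound E_0 there by
     [exp 2] times its value at s, against divergence. For infinite R there is nothing to prove. *)
  assert (Hdom : Rbar_lt (exp (s + y)) (CV_radius b)).
  { destruct (Rbar_lt_dec (exp (s + y)) (CV_radius b)) as [|Hn]; [assumption|exfalso].
    apply Rbar_not_lt_le in Hn.
    pose proof (b_unbounded (fun v => exp 2 * pmom b 0 (exp s) < v)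
                  (ex_intro _ _ (fun v H => H))) as HU.
    apply up_to_exists in HU; [|exact radius_gt0].
    destruct HU as [t1 [T0 [T1 T2]]].
    pose proof (fun x => clan_local_growth t0 s x H2 Hs) as Hgrow.
    clear pos. destruct (CV_radius b) as [r| |]; simpl in *; try easy.
    (* The midpoint of m and r is inside the disk, beyond s, and beyond the threshold t1 from which
       E_0 exceeds the bound. *)
    set (m := Rmax t1 (exp s)).
    assert (Hm : m < r) by (apply Rmax_lub_lt; assumption).
    assert (Hm1 : t1 <= m) by apply Rmax_l.
    assert (Hm2 : exp s <= m) by apply Rmax_r.
    pose proof (exp_pos s).
    specialize (T2 ((m + r) / 2) ltac:(lra) ltac:(lra)).
    specialize (Hgrow (ln ((m + r) / 2))).
    rewrite exp_ln in Hgrow by lra. rewrite <- pmom_0 in T2.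
    cut (pmom b 0 ((m + r) / 2) <= exp 2 * pmom b 0 (exp s)); [lra|].
    apply Hgrow; [ | lra | ].
    - rewrite <- (ln_exp s). apply ln_le; lra.
    - fold y. rewrite <- (ln_exp (s + y)). apply ln_le; lra. }
  split; [exact Hdom|].
  apply (clan_local_growth t0 s (s + y)); auto. lra. unfold y; lra.
Qed.

(** Moving s by E_0/E_1 multiplies the n-th term by exp(n E_0/E_1), which absorbs n^k. The threshold
    t0 is uniform in k. *)
Lemma clan_moments :
  exists t0, 0 < t0 /\ Rbar_lt t0 (CV_radius b) /\
    forall k t, t0 < t -> Rbar_lt t (CV_radius b) ->
      pmom b k t <= INR (fact k) * exp 2 * (pmom b 1 t / pmom b 0 t) ^ k * pmom b 0 t.
Proof.
  destruct clan_growth as [t0 [H0 [H1 H2]]].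
  exists t0. split; [exact H0|split; [exact H1|]]. intros k t Ht Hr.
  assert (Htpos : 0 < t) by lra.
  specialize (H2 (ln t)). rewrite exp_ln in H2 by lra.
  destruct (H2 Ht Hr) as [Hdom Hle]. clear H2.
  pose proof (pos 0 t Htpos Hr) as P0. pose proof (pos 1 t Htpos Hr) as P1.
  set (e0 := pmom b 0 t) in *. set (e1 := pmom b 1 t) in *.
  set (u := exp (ln t + e0 / e1)) in *.
  apply Rle_trans with (pmom b 0 u * (INR (fact k) * (e1 / e0) ^ k)).
  2:{ apply Rle_trans with (exp 2 * e0 * (INR (fact k) * (e1 / e0) ^ k)); [|right; ring].
      apply Rmult_le_compat_r; [|exact Hle].
      apply Rmult_le_pos; [apply pos_INR|apply pow_le, Rlt_le, Rdiv_lt_0_compat; lra]. }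
  apply (is_series_le (fun n => INR n ^ k * b n * t ^ n)
                      (fun n => INR n ^ 0 * b n * u ^ n * (INR (fact k) * (e1 / e0) ^ k))).
  - intros n. rewrite pow_O, Rmult_1_l.
    assert (Hu : u ^ n = t ^ n * exp (INR n * (e0 / e1))).
    { unfold u. rewrite <- !Rpower_pow by (auto using exp_pos). unfold Rpower.
      rewrite ln_exp, <- exp_plus. f_equal. ring. }
    rewrite Hu.
    pose proof (pow_div_fact_le_exp k (INR n * (e0 / e1))
      (Rmult_le_pos _ _ (pos_INR n) (Rlt_le _ _ (Rdiv_lt_0_compat _ _ P0 P1)))) as HE.
    assert (Hn : INR n ^ k = (INR n * (e0 / e1)) ^ k * (e1 / e0) ^ k).
    { rewrite <- Rpow_mult_distr. f_equal. field. lra. }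
    rewrite Hn.
    assert (Hc : 0 <= b n * t ^ n * (e1 / e0) ^ k).
    { apply Rmult_le_pos; [apply Rmult_le_pos|]; auto.
      - apply pow_le; lra.
      - apply pow_le, Rlt_le, Rdiv_lt_0_compat; lra. }
    pose proof (Rmult_le_compat_l _ _ _ Hc HE). lra.
  - apply is_series_pmom; [lra|exact Hr].
  - apply is_series_scal_r. apply is_series_pmom; [apply Rlt_le, exp_pos|exact Hdom].
Qed.

(** The estimate E_0^(1 - k/2) is weakened to its worst case k = 3, namely E_0^(-1/2). This requires
    E_0 >= 1, which the second threshold t1 provides. *)
Lemma ncumulant_bound :
  exists t0, 0 < t0 /\ Rbar_lt t0 (CV_radius b) /\
    forall k t, (3 <= k)%nat -> t0 < t -> Rbar_lt t (CV_radius b) ->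
      0 <= ncumulant b k t
        <= INR (fact k) * exp 2 / sqrt (psum b t).
Proof.
  destruct clan_moments as [t0 [H0 [H1 H2]]].
  pose proof (b_unbounded (fun v => 1 < v) (ex_intro _ _ (fun v H => H))) as HU.
  apply up_to_exists in HU; [|exact radius_gt0].
  destruct HU as [t1 [T0 [T1 T2]]].
  exists (Rmax t0 t1). split; [|split].
  - now apply Rlt_le_trans with t0; [|apply Rmax_l].
  - apply Rmax_case; assumption.
  - intros k t Hk Ht Hr. unfold ncumulant.
    assert (Ht0 : t0 < t) by (eapply Rle_lt_trans; [apply Rmax_l|exact Ht]).
    assert (Ht1 : t1 < t) by (eapply Rle_lt_trans; [apply Rmax_r|exact Ht]).
    assert (Htpos : 0 < t) by lra.
    specialize (H2 k t Ht0 Hr). specialize (T2 t Ht1 Hr).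
    rewrite <- (pmom_0 b t : _ = psum b t) in *.
    pose proof (pos 0 t Htpos Hr) as P0. pose proof (pos 1 t Htpos Hr) as P1.
    pose proof (pos 2 t Htpos Hr) as P2. pose proof (pos k t Htpos Hr) as Pk.
    pose proof (pmom_cauchy_schwarz b b_ge0 b_nonconstant t Htpos Hr) as CS.
    set (e0 := pmom b 0 t) in *. set (e1 := pmom b 1 t) in *. set (e2 := pmom b 2 t) in *.
    assert (Hs2 : 0 < sqrt e2) by now apply sqrt_lt_R0.
    assert (Hs0 : 1 <= sqrt e0).
    { rewrite <- sqrt_1. apply sqrt_le_1; lra. }
    assert (Hmu : 0 < e1 / e0) by now apply Rdiv_lt_0_compat.
    split.
    { apply Rdiv_le_0_compat; [lra|now apply pow_lt]. }
    assert (Hsig : e1 / e0 * sqrt e0 <= sqrt e2).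
    { rewrite <- (sqrt_pow2 (e1 / e0)) by lra.
      rewrite <- sqrt_mult by (try apply pow2_ge_0; lra).
      apply sqrt_le_1; try lra.
      - apply Rmult_le_pos; [apply pow2_ge_0|lra].
      - apply Rmult_le_reg_r with e0; [exact P0|].
        replace ((e1 / e0) ^ 2 * e0 * e0) with (e1 ^ 2) by (field; lra). lra. }
    (* Since [sqrt e0] is at least 1 and k >= 3, its k-th power dominates its cube [e0 * sqrt e0]:
       one factor E_0 cancels the one in the moment bound, and the square root is the gain. *)
    assert (Hsigk : (e1 / e0) ^ k * (e0 * sqrt e0) <= sqrt e2 ^ k).
    { apply Rle_trans with ((e1 / e0 * sqrt e0) ^ k).
      - rewrite Rpow_mult_distr. apply Rmult_le_compat_l; [now apply pow_le, Rlt_le|].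
        replace (e0 * sqrt e0) with (sqrt e0 ^ 3).
        + now apply Rle_pow.
        + simpl. rewrite Rmult_1_r, <- Rmult_assoc, sqrt_sqrt by lra. reflexivity.
      - apply pow_incr. split; [|exact Hsig]. apply Rmult_le_pos; lra. }
    apply Rmult_le_reg_r with (sqrt e2 ^ k * sqrt e0).
    { apply Rmult_lt_0_compat; [now apply pow_lt|lra]. }
    replace (pmom b k t / sqrt e2 ^ k * (sqrt e2 ^ k * sqrt e0)) with (pmom b k t * sqrt e0)
      by (field; apply pow_nonzero; lra).
    replace (INR (fact k) * exp 2 / sqrt e0 * (sqrt e2 ^ k * sqrt e0))
      with (INR (fact k) * exp 2 * sqrt e2 ^ k) by (field; lra).
    apply Rle_trans with (INR (fact k) * exp 2 * ((e1 / e0) ^ k * (e0 * sqrt e0))).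
    + apply Rle_trans with ((INR (fact k) * exp 2 * (e1 / e0) ^ k * e0) * sqrt e0);
        [|right; ring].
      apply Rmult_le_compat_r; lra.
    + apply Rmult_le_compat_l; [|exact Hsigk].
      apply Rmult_le_pos; [apply pos_INR|apply Rlt_le, exp_pos].
Qed.

Lemma ncumulant_lim (k : nat) :
  (3 <= k)%nat ->
  filterlim (ncumulant b k) (up_to (CV_radius b)) (locally 0).
Proof.
  intros Hk. pose proof (up_to_filter _ radius_gt0) as FF.
  apply (filterlim_le_le (fun _ => 0) _ (fun t => INR (fact k) * exp 2 / sqrt (psum b t)) 0).
  - destruct ncumulant_bound as [t0 [H0 [H1 H2]]].
    apply up_to_exists; [exact radius_gt0|]. exists t0. auto.
  - apply filterlim_const.
  - apply (filterlim_comp _ _ _ (psum b) (fun v => INR (fact k) * exp 2 / sqrt v) _ _ _ b_unbounded).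
    change (locally 0) with (Rbar_locally 0).
    replace (Finite 0) with (Rbar_div (INR (fact k) * exp 2) p_infty)
      by (simpl; f_equal; ring).
    apply (is_lim_div (fun _ => INR (fact k) * exp 2) sqrt p_infty (INR (fact k) * exp 2) p_infty).
    + apply is_lim_const.
    + apply is_lim_sqrt_p, is_lim_id.
    + easy.
    + simpl. exact I.
Qed.

Lemma Derive_n_fulcrum (k : nat) (s : R) :
  Rbar_lt (exp s) (CV_radius b) -> Derive_n (fulcrum b) k s = pmom b k (exp s).
Proof.
  revert s. induction k as [|k IH]; intros s Hs; simpl.
  - unfold fulcrum. symmetry. apply pmom_0.
  - apply is_derive_unique.
    apply (is_derive_ext_loc (fun s => pmom b k (exp s))).
    + assert (HL : locally s (fun y => Rbar_lt (exp y) (CV_radius b))).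
      { apply (ex_derive_continuous exp s (ex_intro _ _ (is_derive_exp s))
                 (fun y => Rbar_lt y (CV_radius b))).
        exact (open_Rbar_lt' (exp s) _ Hs). }
      revert HL. apply filter_imp. intros y Hy. symmetry. now apply IH.
    + now apply is_derive_pmom_exp.
Qed.

Lemma fulcrum_cumulant_lim (k : nat) :
  (3 <= k)%nat ->
  filterlim (fun s => Derive_n (fulcrum b) k s / Rpower (Derive_n (fulcrum b) 2 s) (INR k / 2))
    (up_to_ln (CV_radius b)) (locally 0).
Proof.
  intros Hk. pose proof (up_to_ln_filter (CV_radius b)) as FF.
  apply (filterlim_ext_loc (fun s => ncumulant b k (exp s))).
  - apply (filter_imp (fun s => Rbar_lt (exp s) (CV_radius b))).
    + intros s Hs. rewrite !Derive_n_fulcrum by exact Hs. unfold ncumulant. f_equal.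
      (* [Rpower] is defined through [ln], so the passage to powers of the square root rests on E_2
         > 0. *)
      assert (H2 : 0 < pmom b 2 (exp s)) by (apply pos; auto using exp_pos).
      rewrite <- Rpower_pow by now apply sqrt_lt_R0.
      rewrite <- Rpower_sqrt by exact H2. rewrite Rpower_mult. f_equal. field.
    + apply (filterlim_exp_up_to _ radius_gt0 (fun t => Rbar_lt t (CV_radius b))).
      apply up_to_exists; [exact radius_gt0|].
      destruct clan_second_moment as [t0 [H0 [H1 _]]]. exists t0. auto.
  - apply (filterlim_comp _ _ _ exp (ncumulant b k)
             _ (up_to (CV_radius b))).
    + now apply filterlim_exp_up_to.
    + now apply ncumulant_lim.
Qed.

End Clan.

(** * Size biasing and Stein's bound for the family of exp(g) *)

Lemma CV_radius_ge (c : nat -> R) (Rc : Rbar) :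
  (forall t, 0 <= t -> Rbar_lt t Rc -> ex_pseries c t) -> Rbar_le Rc (CV_radius c).
Proof.
  intros H. apply Rbar_not_lt_le. intros Hlt.
  assert (Ht : exists t : R, 0 <= t /\ Rbar_lt (CV_radius c) t /\ Rbar_lt t Rc).
  { pose proof (CV_radius_ge_0 c) as H0.
    destruct (CV_radius c) as [r| |]; destruct Rc as [r'| |]; simpl in *; try easy.
    - exists ((r + r') / 2). lra.
    - exists (r + 1). split; [lra|split; [lra|exact I]]. }
  destruct Ht as [t [H0 [H1 H2]]].
  apply (CV_disk_outside c t).
  - now rewrite Rabs_pos_eq.
  - now apply ex_series_lim_0, ex_pseries_R, H.
Qed.

(** The relation f = e^g is given for t >= 0 only, so coefficients are identified from the right:
    continuity at 0 yields the head, and division by t then reduces each later coefficient to a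
    head. *)
Lemma pseries_head_eq0_right (r : R) (c : nat -> R) :
  0 < r -> Rbar_lt 0 (CV_radius c) ->
  (forall t, 0 < t < r -> PSeries c t = 0) -> c 0%nat = 0.
Proof.
  intros Hr H0 Hz.
  destruct (Req_dec (c 0%nat) 0) as [|Hn]; [assumption|exfalso].
  assert (Hp : 0 < Rabs (c 0%nat)) by now apply Rabs_pos_lt.
  assert (HC : continuous (PSeries c) 0).
  { apply continuity_pt_filterlim, PSeries_continuity. now rewrite Rabs_R0. }
  destruct (HC _ (locally_ball (PSeries c 0) (mkposreal _ Hp))) as [d Hd].
  pose proof (Rmin_pos d r (cond_pos d) Hr).
  pose proof (Rmin_l d r). pose proof (Rmin_r d r).
  specialize (Hd (Rmin d r / 2)). rewrite (Hz (Rmin d r / 2)), PSeries_0 in Hd by lra.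
  unfold ball in Hd; simpl in Hd; unfold AbsRing_ball, abs, minus, plus, opp in Hd; simpl in Hd.
  assert (HH : Rabs (0 + - c 0%nat) < Rabs (c 0%nat)).
  { apply Hd. rewrite Ropp_0, Rplus_0_r. rewrite Rabs_pos_eq by lra. lra. }
  rewrite Rplus_0_l, Rabs_Ropp in HH. lra.
Qed.

Lemma pseries_eq0_right (r : R) (n : nat) : 0 < r -> forall c : nat -> R,
  Rbar_lt 0 (CV_radius c) ->
  (forall t, 0 < t < r -> PSeries c t = 0) -> c n = 0.
Proof.
  intros Hr. induction n as [|n IH]; intros c H0 Hz.
  - now apply (pseries_head_eq0_right r).
  - change (c (S n)) with (PS_decr_1 c n). apply IH; [now rewrite CV_radius_decr_1|].
    intros t Ht. apply Rmult_eq_reg_l with t; [|lra].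
    rewrite <- PSeries_decr_1_aux by now apply (pseries_head_eq0_right r).
    rewrite Rmult_0_r. now apply Hz.
Qed.

Lemma pseries_eq_right (r : R) (c d : nat -> R) :
  0 < r -> Rbar_le r (CV_radius c) -> Rbar_le r (CV_radius d) ->
  (forall t, 0 < t < r -> PSeries c t = PSeries d t) -> forall n, c n = d n.
Proof.
  intros Hr Hc Hd H n.
  assert (Hin : forall t, 0 <= t -> Rbar_lt t r -> ex_pseries c t /\ ex_pseries d t).
  { intros t H0 Ht. split; apply CV_radius_inside; rewrite Rabs_pos_eq by exact H0;
      now apply Rbar_lt_le_trans with r. }
  assert (Hm : Rbar_le r (CV_radius (PS_minus c d))).
  { apply CV_radius_ge. intros t H0 Ht. destruct (Hin t H0 Ht). now apply ex_pseries_minus. }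
  cut (PS_minus c d n = 0); [unfold PS_minus, PS_plus, PS_opp, plus, opp; simpl; lra|].
  apply (pseries_eq0_right r n Hr); [now apply Rbar_lt_le_trans with r|].
  intros t Ht. destruct (Hin t ltac:(lra) (proj2 Ht)).
  rewrite PSeries_minus by assumption. rewrite H by exact Ht. ring.
Qed.

(** * Summation along antidiagonals *)

Lemma sum_antidiagonal (c : nat -> nat -> R) (N : nat) :
  sum_f_R0 (fun n => sum_f_R0 (fun k => c k (n - k)%nat) n) N =
  sum_f_R0 (fun k => sum_f_R0 (c k) (N - k)) N.
Proof.
  induction N as [|N IH]; [reflexivity|].
  rewrite tech5, IH. rewrite tech5 with (N := N). rewrite (tech5 _ N).
  replace (S N - S N)%nat with 0%nat by lia. simpl (sum_f_R0 (c (S N)) 0).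
  rewrite <- Rplus_assoc. f_equal.
  rewrite <- plus_sum. apply sum_eq. intros k Hk.
  replace (S N - k)%nat with (S (N - k)) by lia. now rewrite tech5.
Qed.

(** Bounds what the triangular partial sum omits from one row: both sides are tails beyond M,
    compared term by term. *)
Lemma is_series_tail (c v : nat -> R) (u w V : R) (M : nat) :
  (forall m, Rabs (c m) <= u * v m) -> is_series c w -> is_series v V ->
  Rabs (w - sum_f_R0 c M) <= u * (V - sum_f_R0 v M).
Proof.
  intros H Hc Hv.
  assert (tail : forall (x : nat -> R) l, is_series x l ->
            is_series (fun k => x (S M + k)%nat) (l - sum_f_R0 x M)).
  { intros x l Hx. apply is_series_incr_n; [lia|]. simpl pred. rewrite sum_n_Reals.
    assert (E : l - sum_f_R0 x M + sum_f_R0 x M = l) by ring.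
    unfold plus; simpl. rewrite E. exact Hx. }
  apply tail in Hc. apply tail in Hv. apply (is_series_Rmult u) in Hv.
  apply Rabs_le. split.
  - cut (- (w - sum_f_R0 c M) <= u * (V - sum_f_R0 v M)); [lra|].
    apply (is_series_le _ _ _ _) with (2 := is_series_Ropp _ _ Hc) (3 := Hv).
    intros n.
    specialize (H (S M + n)%nat). apply Rabs_le_between in H. lra.
  - apply (is_series_le _ _ _ _) with (2 := Hc) (3 := Hv).
    intros n.
    specialize (H (S M + n)%nat). apply Rabs_le_between in H. lra.
Qed.

(* Fubini along antidiagonals; the error is dominated by the one of the Cauchy
   product of [u] and [v], which converges by Mertens' theorem. *)
Lemma is_series_antidiagonal (c : nat -> nat -> R) (u v w : nat -> R) :
  (forall k m, Rabs (c k m) <= u k * v m) ->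
  (forall k, 0 <= u k) -> (forall k, 0 <= v k) -> ex_series u -> ex_series v ->
  (forall k, is_series (c k) (w k)) ->
  exists l, is_series w l /\ is_series (fun n => sum_f_R0 (fun k => c k (n - k)%nat) n) l.
Proof.
  intros Hc Hu0 Hv0 [U HU] [V HV] Hw.
  assert (Hwu : forall k, Rabs (w k) <= u k * V).
  { intros k. apply Rabs_le. pose proof (is_series_Rmult (u k) v V HV) as S1.
    split.
    - cut (- w k <= u k * V); [lra|].
      apply (is_series_le _ _ _ _) with (2 := is_series_Ropp _ _ (Hw k)) (3 := S1).
      intros n. specialize (Hc k n). apply Rabs_le_between in Hc.
      lra.
    - apply (is_series_le _ _ _ _) with (2 := Hw k) (3 := S1).
      intros n. specialize (Hc k n). apply Rabs_le_between in Hc.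
      lra. }
  assert (Ew : ex_series w).
  { apply (ex_series_le w (fun k => u k * V)); [exact Hwu|].
    apply ex_series_scal_r. now exists U. }
  exists (Series w). pose proof (Series_correct w Ew) as HS. split; [exact HS|].
  pose proof (is_series_mult_pos u v U V HU HV Hu0 Hv0) as HM.
  set (T := sum_n (fun n => sum_f_R0 (fun k => c k (n - k)%nat) n)).
  set (E := sum_n (fun n => sum_f_R0 (fun k => u k * v (n - k)%nat) n)).
  (* This is the sum over k <= N of u_k times the tail of v beyond N - k, the omitted part of the
     dominating product. Mertens' theorem sends it to U V - U V. *)
  assert (HE : is_lim_seq (fun N => sum_n u N * V - E N) 0).
  { replace 0 with (U * V - U * V) by ring. apply is_lim_seq_minus'.
    - apply is_lim_seq_mult'; [exact HU|apply is_lim_seq_const].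
    - exact HM. }
  assert (HD : is_lim_seq (fun N => sum_n w N - T N) 0).
  { apply (is_lim_seq_le_le (fun N => - (sum_n u N * V - E N)) _ (fun N => sum_n u N * V - E N)).
    2:{ replace (Finite 0) with (Rbar_opp 0) by (simpl; f_equal; ring).
        now apply is_lim_seq_opp in HE. }
    2: exact HE.
    intros N. apply Rabs_le_between. unfold T, E. rewrite !sum_n_Reals.
    rewrite (sum_antidiagonal c), (sum_antidiagonal (fun k m => u k * v m)).
    rewrite <- minus_sum. eapply Rle_trans; [apply Rsum_abs|].
    rewrite (Rmult_comm (sum_f_R0 u N)), scal_sum, <- minus_sum. apply sum_Rle. intros k Hk.
    replace (u k * V - sum_f_R0 (fun m => u k * v m) (N - k))
      with (u k * (V - sum_f_R0 v (N - k))).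
    2:{ rewrite Rmult_minus_distr_l, scal_sum. f_equal. apply sum_eq. intros; ring. }
    apply is_series_tail; auto. }
  change (is_lim_seq T (Series w)).
  apply (is_lim_seq_ext (fun N => sum_n w N - (sum_n w N - T N))).
  - intros N. ring.
  - replace (Finite (Series w)) with (Finite (Series w - 0)) by (f_equal; ring).
    apply is_lim_seq_minus'; [exact HS|exact HD].
Qed.

(** The weight n + 1 is submultiplicative, k + m + 1 <= (k + 1)(m + 1), so a bound on phi(k + m)
    splits into a product. For the proof, (n + 1)^j <= (2 n)^j + 1, the 1 covering n = 0. *)
Lemma ex_series_poly (c : nat -> R) (j : nat) (t : R) :
  (forall n, 0 <= c n) -> 0 <= t -> Rbar_lt t (CV_radius c) ->
  ex_series (fun n => (INR n + 1) ^ j * (c n * t ^ n)).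
Proof.
  intros Hc Ht Hr.
  apply (ex_series_le (fun n => (INR n + 1) ^ j * (c n * t ^ n))
    (fun n => 2 ^ j * (INR n ^ j * c n * t ^ n) + INR n ^ 0 * c n * t ^ n)).
  - intros n. unfold norm; simpl; unfold abs; simpl.
    assert (H0 : 0 <= c n * t ^ n) by (apply Rmult_le_pos; [apply Hc|now apply pow_le]).
    pose proof (pos_INR n).
    rewrite Rabs_pos_eq by (apply Rmult_le_pos; [apply pow_le; lra|exact H0]).
    replace (2 ^ j * (INR n ^ j * c n * t ^ n) + 1 * c n * t ^ n)
      with (((2 * INR n) ^ j + 1) * (c n * t ^ n)) by (rewrite Rpow_mult_distr; ring).
    apply Rmult_le_compat_r; [exact H0|].
    destruct n as [|n].
    + simpl INR. rewrite Rplus_0_l, pow1. pose proof (pow_le (2 * 0) j ltac:(lra)). lra.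
    + apply Rle_trans with ((2 * INR (S n)) ^ j); [|lra].
      apply pow_incr. rewrite S_INR in *. pose proof (pos_INR n). lra.
  - apply (ex_series_plus (fun n => 2 ^ j * (INR n ^ j * c n * t ^ n))).
    + apply (ex_series_scal (2 ^ j) (fun n => INR n ^ j * c n * t ^ n)).
      now apply ex_series_pmom.
    + now apply ex_series_pmom.
Qed.

Lemma is_series_sum_f_R0 (u : nat -> nat -> R) (l : nat -> R) (j : nat) :
  (forall i, (i <= j)%nat -> is_series (u i) (l i)) ->
  is_series (fun n => sum_f_R0 (fun i => u i n) j) (sum_f_R0 l j).
Proof.
  induction j as [|j IH]; intros H; simpl.
  - now apply H.
  - apply (is_series_Rplus (fun n => sum_f_R0 (fun i => u i n) j)); [apply IH|]; auto.
Qed.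

(** * Coefficients of exp(g) and the law of X_t *)

Section ExponentialFamily.

Variables b a : nat -> R.
Hypothesis b_ge0 : forall n, 0 <= b n.
Hypothesis b_nonconstant : exists n, (1 <= n)%nat /\ 0 < b n.
Hypothesis radius_gt0 : Rbar_lt 0 (CV_radius b).
Hypothesis a_exp : forall t, 0 <= t -> Rbar_lt t (CV_radius b) ->
  is_pseries a t (exp (psum b t)).
Hypothesis b_unbounded : filterlim (psum b) (up_to (CV_radius b)) (Rbar_locally p_infty).

Lemma psum_exp (t : R) :
  0 <= t -> Rbar_lt t (CV_radius b) -> psum a t = exp (psum b t).
Proof. intros Ht Hr. now apply is_pseries_unique, a_exp. Qed.

(** If the radius of f exceeded a finite R, f would be continuous at R and so bounded just below it,
    whereas e^g >= 1 + g is unbounded there. *)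
Lemma CV_radius_exp : CV_radius a = CV_radius b.
Proof.
  apply Rbar_le_antisym.
  - apply Rbar_not_lt_le. intros Hlt.
    pose proof psum_exp as Hexp. pose proof b_unbounded as HU. pose proof radius_gt0 as H0.
    destruct (CV_radius b) as [r| |]; simpl in H0; try easy.
    assert (HC : continuous (psum a) r).
    { apply continuity_pt_filterlim, PSeries_continuity. now rewrite Rabs_pos_eq by lra. }
    assert (HL : at_left r (fun t => ball (psum a r) 1 (psum a t))).
    { unfold at_left, within.
      apply (filter_imp (fun t => ball (psum a r) 1 (psum a t))); [now intros t H _|].
      exact (HC _ (locally_ball (psum a r) (mkposreal 1 Rlt_0_1))). }
    specialize (HU (fun v => psum a r + 1 < v) (ex_intro _ _ (fun v H => H))).
    change (at_left r (fun t => psum a r + 1 < psum b t)) in HU.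
    assert (HP : at_left r (fun t => 0 < t < r)).
    { apply (up_to_exists r); [exact H0|]. exists (r / 2). simpl. split; [lra|split; [lra|]].
      intros t H1 H2. lra. }
    assert (HF : at_left r (fun _ => False)).
    { generalize (filter_and _ _ HL (filter_and _ _ HU HP)). apply filter_imp.
      intros t [H1 [H2 H3]].
      rewrite (Hexp t) in H1 by (simpl; lra).
      unfold ball in H1; simpl in H1; unfold AbsRing_ball, abs, minus, plus, opp in H1; simpl in H1.
      apply Rabs_def2 in H1. pose proof (exp_ineq1_le (psum b t)).
      destruct H1. lra. }
    now apply filter_not_empty in HF.
  - apply CV_radius_ge. intros t H0 Ht. eexists. now apply a_exp.
Qed.

Lemma pmom_a_1 (t : R) :
  0 < t -> Rbar_lt t (CV_radius b) -> pmom a 1 t = pmom b 1 t * psum a t.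
Proof.
  intros Ht Hr.
  assert (H : pmom a 1 t / t = pmom b 1 t / t * exp (psum b t)).
  { assert (Ha : is_derive (psum a) t (pmom a 1 t / t)).
    { apply (is_derive_ext (pmom a 0)); [intros; apply pmom_0|].
      apply is_derive_pmom; [lra|]. now rewrite CV_radius_exp, Rabs_pos_eq by lra. }
    assert (Hb : is_derive (fun t => exp (psum b t)) t (pmom b 1 t / t * exp (psum b t))).
    { apply (is_derive_comp exp (psum b)); [apply is_derive_exp|].
      apply (is_derive_ext (pmom b 0)); [intros; apply pmom_0|].
      apply is_derive_pmom; [lra|]. now rewrite Rabs_pos_eq by lra. }
    rewrite <- (is_derive_unique _ _ _ Hb). symmetry. apply is_derive_unique.
    revert Ha. apply is_derive_ext_loc.
    generalize (locally_inside _ t Ht Hr). apply filter_imp.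
    intros x [H0 H1]. apply psum_exp; [lra|exact H1]. }
  rewrite psum_exp by (lra || exact Hr).
  apply Rmult_eq_reg_r with (/ t); [|apply Rinv_neq_0_compat; lra].
  unfold Rdiv in H. rewrite H. ring.
Qed.

(** Comparison of coefficients in t f' = (t g') f. A finite r below the radius is chosen because the
    radius may be infinite. *)
Lemma exp_coef_rec (n : nat) :
  INR n * a n = sum_f_R0 (fun k => INR k * b k * a (n - k)%nat) n.
Proof.
  set (b1 := fun n => INR n ^ 1 * b n).
  assert (Hr : exists r : R, 0 < r /\ Rbar_le r (CV_radius b)).
  { destruct (CV_radius b) as [r| |]; simpl in radius_gt0; try easy.
    - exists r. simpl. lra.
    - exists 1. simpl. split; [lra|exact I]. }
  destruct Hr as [r [Hr0 Hr]].
  assert (Hin : forall t, 0 <= t -> Rbar_lt t r ->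
            Rbar_lt (Rabs t) (CV_radius b1) /\ Rbar_lt (Rabs t) (CV_radius a)).
  { intros t H0 Ht. unfold b1. rewrite CV_radius_pmom, CV_radius_exp, Rabs_pos_eq by exact H0.
    split; now apply Rbar_lt_le_trans with r. }
  replace (INR n * a n) with (INR n ^ 1 * a n) by ring.
  rewrite (sum_eq _ (fun k => b1 k * a (n - k)%nat)) by (intros; unfold b1; ring).
  apply (pseries_eq_right r (fun n => INR n ^ 1 * a n) (PS_mult b1 a)); [exact Hr0| | |].
  - now rewrite CV_radius_pmom, CV_radius_exp.
  - apply CV_radius_ge. intros t H0 Ht. apply ex_pseries_mult; now apply Hin.
  - intros t Ht. destruct (Hin t ltac:(lra) (proj2 Ht)).
    rewrite PSeries_mult by assumption. apply pmom_a_1; [lra|].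
    apply Rbar_lt_le_trans with r; [exact (proj2 Ht)|exact Hr].
Qed.

(** The term k = 0 of the recursion vanishes, so a_n is expressed through earlier coefficients with
    non-negative weights. The induction starts from a_0 = e^(g(0)). *)
Lemma exp_coef_ge0 (n : nat) : 0 <= a n.
Proof.
  induction n as [n IH] using (well_founded_induction Wf_nat.lt_wf).
  destruct n as [|n].
  - rewrite <- (PSeries_0 a). change (0 <= psum a 0).
    rewrite psum_exp; [apply Rlt_le, exp_pos|lra|exact radius_gt0].
  - apply Rmult_le_reg_l with (INR (S n)); [apply lt_0_INR; lia|].
    rewrite Rmult_0_r, exp_coef_rec. apply cond_pos_sum.
    intros [|k].
    + simpl INR. right; ring.
    + apply Rmult_le_pos; [apply Rmult_le_pos; [apply pos_INR|apply b_ge0]|].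
      apply IH; lia.
Qed.

Lemma mean_h_exp (t : R) :
  0 < t -> Rbar_lt t (CV_radius b) -> mean_h a t = pmom b 1 t.
Proof.
  intros Ht Hr. rewrite mean_h_eq by (try rewrite CV_radius_exp; assumption).
  rewrite pmom_a_1, pmom_0 by assumption.
  change (PSeries a t) with (psum a t). rewrite psum_exp by (lra || assumption).
  field. apply Rgt_not_eq, exp_pos.
Qed.

Lemma sd_h_exp (t : R) :
  0 < t -> Rbar_lt t (CV_radius b) -> sd_h a t = sqrt (pmom b 2 t).
Proof.
  intros Ht Hr. unfold sd_h, var_h. f_equal.
  replace (Derive (mean_h a) t) with (pmom b 2 t / t); [field; lra|].
  symmetry. apply is_derive_unique.
  apply (is_derive_ext_loc (pmom b 1)).
  - generalize (locally_inside _ t Ht Hr). apply filter_imp.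
    intros x [H0 H1]. symmetry. now apply mean_h_exp.
  - apply is_derive_pmom; [lra|]. now rewrite Rabs_pos_eq by lra.
Qed.

Section FixedTime.

Variable t : R.
Hypothesis t_gt0 : 0 < t.
Hypothesis t_inside : Rbar_lt t (CV_radius b).

Let P := khin_prob a t.
Let W := normalized a t.
Let mu := pmom b 1 t.
Let sigma := sqrt (pmom b 2 t).

Lemma psum_a_gt0 : 0 < psum a t.
Proof. rewrite psum_exp; [apply exp_pos|lra|exact t_inside]. Qed.

Lemma sigma_gt0 : 0 < sigma.
Proof. now apply sqrt_lt_R0, pmom_gt0. Qed.

Lemma khin_prob_ge0 (n : nat) : 0 <= P n.
Proof.
  apply Rdiv_le_0_compat; [|apply psum_a_gt0].
  apply Rmult_le_pos; [apply exp_coef_ge0|apply pow_le; lra].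
Qed.

Lemma khin_prob_total : is_series P 1.
Proof.
  apply (is_series_ext (fun n => a n * t ^ n * / psum a t)); [intros n; reflexivity|].
  replace 1 with (psum a t * / psum a t) by (field; apply Rgt_not_eq, psum_a_gt0).
  apply is_series_scal_r, is_pseries_R.
  rewrite psum_exp by (lra || exact t_inside). apply a_exp; [lra|exact t_inside].
Qed.

Lemma ex_series_khin_poly (j : nat) : ex_series (fun n => (INR n + 1) ^ j * P n).
Proof.
  apply (ex_series_ext (fun n => (INR n + 1) ^ j * (a n * t ^ n) * / psum a t)).
  - intros n. unfold P, khin_prob. real_eq. unfold Rdiv. ring.
  - apply ex_series_scal_r, ex_series_poly; [apply exp_coef_ge0|lra|].
    now rewrite CV_radius_exp.
Qed.

Lemma ex_series_khin (phi : nat -> R) (C : R) (j : nat) :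
  (forall n, Rabs (phi n) <= C * (INR n + 1) ^ j) -> ex_series (fun n => phi n * P n).
Proof.
  intros H.
  apply (ex_series_le (fun n => phi n * P n) (fun n => C * ((INR n + 1) ^ j * P n))).
  - intros n. unfold norm; simpl; unfold abs; simpl.
    rewrite Rabs_mult, (Rabs_pos_eq (P n)) by apply khin_prob_ge0.
    rewrite <- Rmult_assoc. apply Rmult_le_compat_r; [apply khin_prob_ge0|apply H].
  - apply (ex_series_scal C (fun n => (INR n + 1) ^ j * P n)), ex_series_khin_poly.
Qed.

(* [X_t] is compound Poisson: size-biasing it adds an independent variable of
   law [k b_k t^k / mu]. *)
Lemma size_bias (phi w : nat -> R) (C : R) (j : nat) :
  (forall n, Rabs (phi n) <= C * (INR n + 1) ^ j) ->
  (forall k, is_series (fun m => phi (k + m)%nat * P m) (w k)) ->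
  exists l, is_series (fun n => INR n * phi n * P n) l /\
            is_series (fun k => INR k ^ 1 * b k * t ^ k * w k) l.
Proof.
  intros Hphi Hw.
  set (c := fun k m => INR k ^ 1 * b k * t ^ k * (phi (k + m)%nat * P m)).
  assert (Hb : forall k, 0 <= INR k ^ 1 * b k * t ^ k).
  { intros k. apply (pmom_term_ge0 b b_ge0 1 t k). lra. }
  assert (Hpow : forall (x : nat) , 0 <= (INR x + 1) ^ j).
  { intros x. apply pow_le. pose proof (pos_INR x). lra. }
  assert (HC : 0 <= C).
  { pose proof (Hphi 0%nat) as H. simpl INR in H. rewrite Rplus_0_l, pow1, Rmult_1_r in H.
    apply Rle_trans with (2 := H), Rabs_pos. }
  destruct (is_series_antidiagonal c
    (fun k => (INR k + 1) ^ j * (INR k ^ 1 * b k * t ^ k))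
    (fun m => C * ((INR m + 1) ^ j * P m))
    (fun k => INR k ^ 1 * b k * t ^ k * w k)) as [l [H1 H2]].
  - intros k m. unfold c. rewrite Rabs_mult, (Rabs_mult (phi (k + m)%nat)).
    rewrite (Rabs_pos_eq _ (Hb k)), (Rabs_pos_eq (P m)) by apply khin_prob_ge0.
    apply Rle_trans with (INR k ^ 1 * b k * t ^ k *
       ((C * ((INR k + 1) ^ j * (INR m + 1) ^ j)) * P m)); [|right; ring].
    apply Rmult_le_compat_l; [apply Hb|].
    apply Rmult_le_compat_r; [apply khin_prob_ge0|].
    eapply Rle_trans; [apply Hphi|]. apply Rmult_le_compat_l; [exact HC|].
    rewrite <- Rpow_mult_distr. rewrite plus_INR.
    pose proof (pos_INR k). pose proof (pos_INR m).
    apply pow_incr. split; [lra|]. nra.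
  - intros k. apply Rmult_le_pos; [apply Hpow|apply Hb].
  - intros m. apply Rmult_le_pos; [exact HC|].
    apply Rmult_le_pos; [apply Hpow|apply khin_prob_ge0].
  - apply (ex_series_poly (fun k => INR k ^ 1 * b k)); [|lra|now rewrite CV_radius_pmom].
    intros n. apply Rmult_le_pos; [apply pow_le, pos_INR|apply b_ge0].
  - apply (ex_series_scal C (fun n => (INR n + 1) ^ j * P n)), ex_series_khin_poly.
  - intros k. apply (is_series_Rmult (INR k ^ 1 * b k * t ^ k) _ _ (Hw k)).
  - exists l. split; [|exact H1].
    revert H2. apply is_series_ext. intros n.
    (* On the n-th antidiagonal phi and t^k t^(n-k) = t^n are constant, and what is left is the
       coefficient recursion for n a_n. *)
    transitivity (phi n * t ^ n / psum a t * (INR n * a n)).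
    + rewrite exp_coef_rec, scal_sum. apply sum_eq. intros k Hk. unfold c, P, khin_prob.
      replace (k + (n - k))%nat with n by lia.
      replace (t ^ n) with (t ^ k * t ^ (n - k)).
      * unfold Rdiv; ring.
      * rewrite <- pow_add. f_equal. lia.
    + unfold P, khin_prob. real_eq. unfold Rdiv. ring.
Qed.

Lemma normalized_eq (n : nat) : W n = (INR n - mu) / sigma.
Proof. unfold W, normalized. now rewrite mean_h_exp, sd_h_exp. Qed.

Lemma normalized_plus (k m : nat) : W (k + m) = W m + INR k / sigma.
Proof. rewrite !normalized_eq, plus_INR. field. apply Rgt_not_eq, sigma_gt0. Qed.

Lemma normalized_growth (n : nat) : Rabs (W n) <= (1 + mu) / sigma * (INR n + 1).
Proof.
  rewrite normalized_eq. pose proof sigma_gt0.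
  assert (Hmu : 0 < mu) by now apply pmom_gt0.
  unfold Rdiv. rewrite Rabs_mult, (Rabs_pos_eq (/ sigma)) by (apply Rlt_le, Rinv_0_lt_compat; lra).
  rewrite (Rmult_comm (1 + mu)), (Rmult_comm (Rabs _)), Rmult_assoc.
  apply Rmult_le_compat_l; [apply Rlt_le, Rinv_0_lt_compat; lra|].
  pose proof (pos_INR n). apply Rabs_le. nra.
Qed.

Lemma is_series_moment (j : nat) : is_series (fun n => W n ^ j * P n) (khin_moment a t j).
Proof.
  apply Series_correct.
  apply (ex_series_khin _ (((1 + mu) / sigma) ^ j) j).
  intros n. rewrite <- RPow_abs, <- Rpow_mult_distr.
  apply pow_incr. split; [apply Rabs_pos|apply normalized_growth].
Qed.

Lemma khin_moment_0 : khin_moment a t 0 = 1.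
Proof.
  apply is_series_unique, (is_series_ext P); [|apply khin_prob_total].
  intros n. simpl. symmetry. apply Rmult_1_l.
Qed.

(** Size bias for phi = W^j. On the left X = sigma W + mu; on the right adding k to X adds k/sigma
    to W, and after the binomial expansion the sum over k of k^(j-i+1) b_k t^k is E_(j-i+1). *)
Lemma khin_moment_expansion (j : nat) :
  sigma * khin_moment a t (S j) + mu * khin_moment a t j =
  sum_f_R0 (fun i => Binomial.C j i * khin_moment a t i *
                     (pmom b (S (j - i)) t / sigma ^ (j - i))) j.
Proof.
  pose proof sigma_gt0 as Hs.
  destruct (size_bias (fun n => W n ^ j)
    (fun k => sum_f_R0 (fun i => Binomial.C j i * (INR k / sigma) ^ (j - i) * khin_moment a t i) j)
    (((1 + mu) / sigma) ^ j) j) as [l [H1 H2]].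
  - intros n. rewrite <- RPow_abs, <- Rpow_mult_distr.
    apply pow_incr. split; [apply Rabs_pos|apply normalized_growth].
  - intros k.
    apply (is_series_ext (fun m => sum_f_R0 (fun i =>
      Binomial.C j i * (INR k / sigma) ^ (j - i) * (W m ^ i * P m)) j)).
    + intros m. rewrite normalized_plus, binomial, (Rmult_comm _ (P m)), scal_sum.
      apply sum_eq. intros; ring.
    + apply (is_series_sum_f_R0 (fun i m =>
        Binomial.C j i * (INR k / sigma) ^ (j - i) * (W m ^ i * P m))).
      intros i Hi. apply (is_series_Rmult (Binomial.C j i * (INR k / sigma) ^ (j - i))).
      apply is_series_moment.
  - transitivity l.
    + symmetry. apply (filterlim_locally_unique _ _ _ H1).
      generalize (is_series_Rplus _ _ _ _ (is_series_Rmult sigma _ _ (is_series_moment (S j)))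
                   (is_series_Rmult mu _ _ (is_series_moment j))).
      apply is_series_ext. intros n. real_eq.
      replace (INR n) with (sigma * W n + mu) by (rewrite normalized_eq; field; lra).
      simpl. ring.
    + apply (filterlim_locally_unique _ _ _ H2).
      apply (is_series_ext (fun k => sum_f_R0 (fun i =>
        Binomial.C j i * khin_moment a t i / sigma ^ (j - i) * (INR k ^ S (j - i) * b k * t ^ k)) j)).
      * intros k. rewrite scal_sum. apply sum_eq. intros i Hi.
        unfold Rdiv. rewrite Rpow_mult_distr, pow_inv. simpl. real_eq. ring.
      * rewrite (sum_eq _ (fun i => Binomial.C j i * khin_moment a t i / sigma ^ (j - i) *
                                 pmom b (S (j - i)) t)) by (intros; unfold Rdiv; ring).
        apply (is_series_sum_f_R0 (fun i k =>
          Binomial.C j i * khin_moment a t i / sigma ^ (j - i) * (INR k ^ S (j - i) * b k * t ^ k))).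
        intros i Hi.
        apply (is_series_Rmult (Binomial.C j i * khin_moment a t i / sigma ^ (j - i))).
        apply is_series_pmom; [lra|exact t_inside].
Qed.

Lemma khin_moment_1 : khin_moment a t 1 = 0.
Proof.
  pose proof (khin_moment_expansion 0) as H. pose proof sigma_gt0.
  simpl in H. rewrite khin_moment_0 in H. unfold Binomial.C in H. simpl in H.
  unfold mu in H.
  apply Rmult_eq_reg_l with sigma; [|lra]. rewrite Rmult_0_r.
  replace (pmom b 1 t / 1) with (pmom b 1 t) in H by field.
  replace (1 / (1 * 1)) with 1 in H by field. lra.
Qed.

Lemma ncumulant_2 : ncumulant b 2 t = 1.
Proof.
  unfold ncumulant. rewrite <- Rsqr_pow2.
  assert (0 < pmom b 2 t) by now apply pmom_gt0.
  rewrite Rsqr_sqrt by lra. field. lra.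
Qed.

Lemma binomial_C_diag (j : nat) : Binomial.C j j = 1.
Proof.
  unfold Binomial.C. rewrite Nat.sub_diag. simpl (fact 0). simpl INR.
  field. apply INR_fact_neq_0.
Qed.

(** The last term of the expansion is mu times the moment of order j + 1 and cancels the same term
    on the left. After division by sigma only cumulants of order at least 2 remain. *)
Lemma khin_moment_rec (j : nat) :
  khin_moment a t (S (S j)) =
  sum_f_R0 (fun i => Binomial.C (S j) i * khin_moment a t i * ncumulant b (S (S j) - i) t) j.
Proof.
  pose proof (khin_moment_expansion (S j)) as H. pose proof sigma_gt0 as Hs.
  rewrite tech5 in H. rewrite Nat.sub_diag, binomial_C_diag in H.
  replace (pmom b 1 t / sigma ^ 0) with mu in H by (unfold mu; simpl; field).
  apply Rmult_eq_reg_l with sigma; [|lra].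
  rewrite scal_sum.
  rewrite (sum_eq _ (fun i => Binomial.C (S j) i * khin_moment a t i *
              (pmom b (S (S j - i)) t / sigma ^ (S j - i)))); [lra|].
  intros i Hi. unfold ncumulant. fold sigma. replace (S (S j) - i)%nat with (S (S j - i)) by lia.
  rewrite <- (tech_pow_Rmult sigma). field. split; [|lra]. apply pow_nonzero; lra.
Qed.

(** Size bias for phi = f(W), with f(W + k/sigma) expanded to first order. The zeroth-order terms
    sum to mu E[f(W)], the first-order ones to (E_2/sigma) E[f'(W)] = sigma E[f'(W)], and the
    remainder is at most B E_3/sigma^2; dividing by sigma gives the claim. *)
Lemma stein_bound (f f1 f2 : R -> R) (B D : R) :
  (forall x, is_derive f x (f1 x)) -> (forall x, is_derive f1 x (f2 x)) ->
  (forall x, Rabs (f x) <= D) -> (forall x, Rabs (f2 x) <= B) ->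
  ex_series (fun n => (W n * f (W n) - f1 (W n)) * P n) /\
  Rabs (Series (fun n => (W n * f (W n) - f1 (W n)) * P n)) <= B * ncumulant b 3 t.
Proof.
  intros Hf Hf1 HD HB. pose proof sigma_gt0 as Hs.
  assert (HB0 : 0 <= B) by (apply Rle_trans with (2 := HB 0), Rabs_pos).
  assert (HL : forall x y, Rabs (f1 y - f1 x) <= B * Rabs (y - x)).
  { intros x y. destruct (MVT_gen f1 x y f2) as [z [_ Hz]].
    - intros; apply Hf1.
    - intros z _. apply continuity_pt_filterlim, (ex_derive_continuous f1).
      eexists; apply Hf1.
    - rewrite Hz, Rabs_mult. apply Rmult_le_compat_r; [apply Rabs_pos|apply HB]. }
  (* Two uses of the mean value theorem replace Taylor's formula; they cost the factor 1/2, which is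
     immaterial. *)
  assert (HT : forall x d, Rabs (f (x + d) - f x - d * f1 x) <= B * d ^ 2).
  { intros x d. destruct (MVT_gen f x (x + d) f1) as [z [Hzb Hz]].
    - intros; apply Hf.
    - intros z _. apply continuity_pt_filterlim, (ex_derive_continuous f).
      eexists; apply Hf.
    - rewrite Hz. replace (f1 z * (x + d - x) - d * f1 x) with (d * (f1 z - f1 x)) by ring.
      rewrite Rabs_mult. rewrite <- pow2_abs.
      apply Rle_trans with (Rabs d * (B * Rabs d)); [|right; ring].
      apply Rmult_le_compat_l; [apply Rabs_pos|].
      eapply Rle_trans; [apply HL|]. apply Rmult_le_compat_l; [exact HB0|].
      revert Hzb. unfold Rmin, Rmax. destruct (Rle_dec x (x + d)); intros Hzb.
      + rewrite !Rabs_pos_eq; lra.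
      + rewrite !Rabs_left1; lra. }
  assert (Hb1 : is_series (fun k => INR k ^ 1 * b k * t ^ k) mu)
    by (apply is_series_pmom; [lra|exact t_inside]).
  assert (Hb2 : is_series (fun k => INR k ^ 2 * b k * t ^ k) (pmom b 2 t))
    by (apply is_series_pmom; [lra|exact t_inside]).
  assert (Hb3 : is_series (fun k => INR k ^ 3 * b k * t ^ k) (pmom b 3 t))
    by (apply is_series_pmom; [lra|exact t_inside]).
  assert (Ef : ex_series (fun n => f (W n) * P n)).
  { apply (ex_series_khin _ D 0). intros n. rewrite Rmult_1_r. apply HD. }
  (* The Lipschitz bound makes [f1 (W n)] grow at most linearly in n, which the law of X_t can
     sum. *)
  assert (Ef1 : ex_series (fun n => f1 (W n) * P n)).
  { apply (ex_series_khin _ (Rabs (f1 0) + B * ((1 + mu) / sigma)) 1).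
    intros n. rewrite pow_1. pose proof (HL 0 (W n)) as H. rewrite Rminus_0_r in H.
    pose proof (normalized_growth n) as Hg. pose proof (pos_INR n) as Hn.
    pose proof (Rmult_le_compat_l _ _ _ HB0 Hg).
    pose proof (Rabs_triang (f1 (W n) - f1 0) (f1 0)) as HTr.
    replace (f1 (W n) - f1 0 + f1 0) with (f1 (W n)) in HTr by ring.
    pose proof (Rabs_pos (f1 0)). nra. }
  assert (Es : forall k, ex_series (fun m => f (W (k + m)%nat) * P m)).
  { intros k. apply (ex_series_khin _ D 0). intros n. rewrite Rmult_1_r. apply HD. }
  apply Series_correct in Ef. apply Series_correct in Ef1.
  set (e := Series (fun n => f (W n) * P n)) in *.
  set (e1 := Series (fun n => f1 (W n) * P n)) in *.
  set (w := fun k => Series (fun m => f (W (k + m)%nat) * P m)).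
  assert (Hw : forall k, is_series (fun m => f (W (k + m)%nat) * P m) (w k))
    by (intros k; now apply Series_correct).
  destruct (size_bias (fun n => f (W n)) w D 0) as [l [H1 H2]].
  { intros n. rewrite Rmult_1_r. apply HD. }
  { exact Hw. }
  assert (Hdiff : forall k, Rabs (w k - e - INR k / sigma * e1) <= B * (INR k / sigma) ^ 2).
  { intros k.
    assert (HS : is_series (fun m => (f (W m + INR k / sigma) - f (W m) - INR k / sigma * f1 (W m)) * P m)
                   (w k - e - INR k / sigma * e1)).
    { generalize (is_series_Rminus _ _ _ _ (is_series_Rminus _ _ _ _ (Hw k) Ef)
                   (is_series_Rmult (INR k / sigma) _ _ Ef1)).
      apply is_series_ext. intros m. rewrite normalized_plus.
      real_eq. ring. }
    pose proof (is_series_Rmult (B * (INR k / sigma) ^ 2) _ _ khin_prob_total) as HK.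
    rewrite Rmult_1_r in HK.
    apply Rabs_le. split.
    - cut (- (w k - e - INR k / sigma * e1) <= B * (INR k / sigma) ^ 2); [lra|].
      apply (is_series_le _ _ _ _) with (2 := is_series_Ropp _ _ HS) (3 := HK).
      intros m. specialize (HT (W m) (INR k / sigma)).
      apply Rabs_le_between in HT. pose proof (khin_prob_ge0 m).
      rewrite Ropp_mult_distr_l. apply Rmult_le_compat_r; [assumption|simpl in *; lra].
    - apply (is_series_le _ _ _ _) with (2 := HS) (3 := HK).
      intros m. specialize (HT (W m) (INR k / sigma)).
      apply Rabs_le_between in HT. pose proof (khin_prob_ge0 m).
      apply Rmult_le_compat_r; [assumption|simpl in *; lra]. }
  assert (Hsig2 : pmom b 2 t = sigma ^ 2).
  { rewrite <- Rsqr_pow2. unfold sigma. rewrite Rsqr_sqrt; [reflexivity|].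
    now apply Rlt_le, pmom_gt0. }
  assert (Hmain : is_series (fun n => (W n * f (W n) - f1 (W n)) * P n)
                    ((l - mu * e) / sigma - e1)).
  { generalize (is_series_Rminus _ _ _ _ (is_series_Rmult (/ sigma) _ _
        (is_series_Rminus _ _ _ _ H1 (is_series_Rmult mu _ _ Ef))) Ef1).
    replace (/ sigma * (l - mu * e) - e1) with ((l - mu * e) / sigma - e1)
      by (unfold Rdiv; ring).
    apply is_series_ext. intros n. real_eq.
    replace (INR n) with (sigma * W n + mu) by (rewrite normalized_eq; field; lra).
    field. lra. }
  split; [eexists; exact Hmain|].
  rewrite (is_series_unique _ _ Hmain).
  assert (HS : is_series (fun k => INR k ^ 1 * b k * t ^ k * (w k - e - INR k / sigma * e1))
                 (l - mu * e - sigma * e1)).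
  { generalize (is_series_Rminus _ _ _ _ (is_series_Rminus _ _ _ _ H2 (is_series_Rmult e _ _ Hb1))
        (is_series_Rmult (e1 / sigma) _ _ Hb2)).
    replace (l - e * mu - e1 / sigma * pmom b 2 t) with (l - mu * e - sigma * e1)
      by (rewrite Hsig2; field; lra).
    apply is_series_ext. intros k. real_eq. field. lra. }
  pose proof (is_series_Rmult (B / sigma ^ 2) _ _ Hb3) as HK.
  replace ((l - mu * e) / sigma - e1) with ((l - mu * e - sigma * e1) / sigma) by (field; lra).
  unfold Rdiv at 1. rewrite Rabs_mult, (Rabs_pos_eq (/ sigma)) by (apply Rlt_le, Rinv_0_lt_compat; lra).
  apply Rmult_le_reg_r with sigma; [exact Hs|].
  rewrite Rmult_assoc, Rinv_l, Rmult_1_r by lra.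
  replace (B * ncumulant b 3 t * sigma) with (B / sigma ^ 2 * (pmom b 3 t)).
  2:{ unfold ncumulant. fold sigma. field. lra. }
  assert (Hterm : forall k, Rabs (INR k ^ 1 * b k * t ^ k * (w k - e - INR k / sigma * e1))
                    <= B / sigma ^ 2 * (INR k ^ 3 * b k * t ^ k)).
  { intros k. rewrite Rabs_mult.
    assert (H0 : 0 <= INR k ^ 1 * b k * t ^ k) by (apply pmom_term_ge0; [exact b_ge0|lra]).
    rewrite (Rabs_pos_eq _ H0).
    apply Rle_trans with (INR k ^ 1 * b k * t ^ k * (B * (INR k / sigma) ^ 2)).
    - apply Rmult_le_compat_l; [exact H0|apply Hdiff].
    - right. field. lra. }
  apply Rabs_le. split.
  - cut (- (l - mu * e - sigma * e1) <= B / sigma ^ 2 * (pmom b 3 t)); [lra|].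
    apply (is_series_le _ _ _ _) with (2 := is_series_Ropp _ _ HS) (3 := HK).
    intros k. specialize (Hterm k). apply Rabs_le_between in Hterm.
    lra.
  - apply (is_series_le _ _ _ _) with (2 := HS) (3 := HK).
    intros k. specialize (Hterm k). apply Rabs_le_between in Hterm. apply Hterm.
Qed.

End FixedTime.

End ExponentialFamily.

(** * The Gaussian integral and the normal moments *)

(* [auto_derive] leaves derivatives of eta-expanded functions. *)
Ltac rewrite_Derive H :=
  let E := fresh in
  pose proof (is_derive_unique _ _ _ H) as E;
  match type of E with
  | Derive ?f ?z = ?l => change (Derive (fun x => f x) z = l) in E; rewrite E; clear E
  end.

Definition gauss (u : R) : R := exp (- (u ^ 2) / 2).

Lemma is_derive_continuous (f : R -> R) (x l : R) : is_derive f x l -> continuous f x.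
Proof. intros H. apply (ex_derive_continuous f). now exists l. Qed.

Lemma ex_RInt_total (f : R -> R) (x y : R) : (forall z, continuous f z) -> ex_RInt f x y.
Proof. intros H. apply (ex_RInt_continuous f). intros; apply H. Qed.

Lemma is_derive_primitive (f : R -> R) (c x : R) :
  (forall z, continuous f z) -> is_derive (fun y => RInt f c y) x (f x).
Proof.
  intros H. apply (is_derive_RInt f _ c); [|apply H].
  apply filter_forall. intros y. now apply (RInt_correct f), ex_RInt_total.
Qed.

Lemma is_derive_gauss (x : R) : is_derive gauss x (- x * gauss x).
Proof. unfold gauss, Rdiv. auto_derive; [exact I|]. simpl. field. Qed.

Lemma gauss_cont (x : R) : continuous gauss x.
Proof. eapply is_derive_continuous, is_derive_gauss. Qed.

Lemma gauss_gt0 (x : R) : 0 < gauss x.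
Proof. apply exp_pos. Qed.

Definition gauss_int (x : R) : R := RInt gauss 0 x.

Lemma is_derive_gauss_int (x : R) : is_derive gauss_int x (gauss x).
Proof. apply (is_derive_primitive gauss), gauss_cont. Qed.

Lemma is_derive_eq0_const (f : R -> R) (x y : R) :
  (forall z, is_derive f z 0) -> f x = f y.
Proof.
  intros H. destruct (MVT_gen f y x (fun _ => 0)) as [c [_ Hc]].
  - intros; apply H.
  - intros z _. eapply continuity_pt_filterlim, is_derive_continuous, H.
  - lra.
Qed.

(** Companion of the squared Gaussian integral: differentiating in x cancels 1 + v^2, and the
    substitution u = x v turns the result into [- (gauss x * gauss_int x)]. Hence
    [gauss_int ^ 2 + 2 * polar_int] is constant. *)
Definition polar_int (x : R) : R :=
  RInt (fun v => exp (- (x ^ 2 * (1 + v ^ 2)) / 2) / (1 + v ^ 2)) 0 1.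

Lemma polar_integrand_cont (x v : R) :
  continuous (fun v => exp (- (x ^ 2 * (1 + v ^ 2)) / 2) / (1 + v ^ 2)) v.
Proof.
  eapply is_derive_continuous. auto_derive; [|reflexivity].
  pose proof (pow2_ge_0 v). simpl in *. lra.
Qed.

Lemma is_derive_polar_integrand (x v : R) :
  is_derive (fun x => exp (- (x ^ 2 * (1 + v ^ 2)) / 2) / (1 + v ^ 2)) x
    (- x * exp (- (x ^ 2 * (1 + v ^ 2)) / 2)).
Proof.
  unfold Rdiv. auto_derive; [exact I|].
  simpl. field. nra.
Qed.

Lemma is_derive_polar_int (x : R) :
  is_derive polar_int x (- (gauss x * gauss_int x)).
Proof.
  replace (- (gauss x * gauss_int x)) with
    (RInt (fun v => Derive (fun u => exp (- (u ^ 2 * (1 + v ^ 2)) / 2) / (1 + v ^ 2)) x) 0 1).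
  - apply (is_derive_RInt_param
      (fun u v => exp (- (u ^ 2 * (1 + v ^ 2)) / 2) / (1 + v ^ 2))).
    + apply filter_forall. intros y v _. eexists. apply is_derive_polar_integrand.
    + intros v _.
      apply (continuity_2d_pt_ext (fun u v => - u * exp (- (u * u * (1 + v * v)) * / 2))).
      * intros u w. symmetry.
        etransitivity; [exact (is_derive_unique _ _ _ (is_derive_polar_integrand u w))|].
        do 2 f_equal. field.
      * apply continuity_2d_pt_mult; [apply continuity_2d_pt_opp, continuity_2d_pt_id1|].
        apply (continuity_1d_2d_pt_comp exp).
        { apply continuity_pt_filterlim, (is_derive_continuous exp _ _ (is_derive_exp _)). }
        apply continuity_2d_pt_mult; [|apply continuity_2d_pt_const].
        apply continuity_2d_pt_opp.
        apply continuity_2d_pt_mult.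
        -- apply continuity_2d_pt_mult; apply continuity_2d_pt_id1.
        -- apply continuity_2d_pt_plus; [apply continuity_2d_pt_const|].
           apply continuity_2d_pt_mult; apply continuity_2d_pt_id2.
    + apply filter_forall. intros y. apply ex_RInt_total, polar_integrand_cont.
  - transitivity (RInt (fun v => - gauss x * (x * gauss (x * v + 0))) 0 1).
    + apply RInt_ext. intros v _.
      etransitivity; [exact (is_derive_unique _ _ _ (is_derive_polar_integrand x v))|].
      unfold gauss. real_eq.
      replace (exp (- (x ^ 2 * (1 + v ^ 2)) / 2))
        with (exp (- (x ^ 2) / 2) * exp (- ((x * v + 0) ^ 2) / 2)); [ring|].
      rewrite <- exp_plus. f_equal. field.
    + assert (Hex : ex_RInt (fun v => x * gauss (x * v + 0)) 0 1).
      { apply ex_RInt_total. intros v. eapply is_derive_continuous. unfold gauss.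
        auto_derive; [exact I|reflexivity]. }
      transitivity (- gauss x * RInt (fun v => x * gauss (x * v + 0)) 0 1).
      { exact (RInt_scal (fun v => x * gauss (x * v + 0)) 0 1 (- gauss x) Hex). }
      transitivity (- gauss x * RInt gauss (x * 0 + 0) (x * 1 + 0)).
      { f_equal. apply (RInt_comp_lin gauss x 0 0 1), ex_RInt_total, gauss_cont. }
      rewrite Rmult_0_r, Rmult_1_r, !Rplus_0_r. unfold gauss_int. real_eq. ring.
Qed.

(** The constant is evaluated at x = 0, where [polar_int] is the integral of 1/(1 + v^2) over
    [0, 1], that is [atan 1]. *)
Lemma gauss_int_sqr (x : R) : gauss_int x ^ 2 = PI / 2 - 2 * polar_int x.
Proof.
  assert (H : gauss_int x ^ 2 + 2 * polar_int x = gauss_int 0 ^ 2 + 2 * polar_int 0).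
  { apply (is_derive_eq0_const (fun x => gauss_int x ^ 2 + 2 * polar_int x)).
    intros z. pose proof (is_derive_gauss_int z) as H1. pose proof (is_derive_polar_int z) as H2.
    auto_derive.
    - split; [now exists (gauss z)|]. split; [eexists; exact H2|exact I].
    - rewrite_Derive H1. rewrite_Derive H2. ring. }
  assert (H0 : gauss_int 0 = 0) by apply (RInt_point 0 gauss).
  assert (Hp : polar_int 0 = PI / 4).
  { unfold polar_int.
    rewrite (RInt_ext _ (fun v => / (1 + Rsqr v))).
    - apply is_RInt_unique.
      replace (PI / 4) with (minus (atan 1) (atan 0)).
      + apply (is_RInt_derive atan).
        * intros v _. apply is_derive_atan.
        * intros v _. eapply is_derive_continuous. unfold Rsqr.
          auto_derive; [|reflexivity]. pose proof (Rle_0_sqr v). unfold Rsqr in *. lra.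
      + rewrite atan_1, atan_0. unfold minus, plus, opp; simpl. ring.
    - intros v _. replace (- (0 ^ 2 * (1 + v ^ 2)) / 2) with 0 by field.
      rewrite exp_0, Rsqr_pow2. real_eq. unfold Rdiv. apply Rmult_1_l. }
  rewrite H0, Hp in H. lra.
Qed.

Lemma polar_int_bounds (x : R) : 0 <= polar_int x <= gauss x.
Proof.
  assert (Hv : forall v, 0 < / (1 + v ^ 2) <= 1).
  { intros v. pose proof (pow2_ge_0 v). split; [apply Rinv_0_lt_compat; lra|].
    rewrite <- Rinv_1. apply Rinv_le_contravar; lra. }
  split.
  - apply RInt_ge_0; [lra|apply ex_RInt_total, polar_integrand_cont|].
    intros v _. apply Rmult_le_pos; [apply Rlt_le, exp_pos|]. apply Rlt_le, Hv.
  - replace (gauss x) with (RInt (fun _ => gauss x) 0 1).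
    2:{ rewrite RInt_const. unfold scal; simpl; unfold mult; simpl. ring. }
    apply RInt_le; [lra|apply ex_RInt_total, polar_integrand_cont|apply ex_RInt_const|].
    intros v _. unfold gauss.
    apply Rle_trans with (exp (- (x ^ 2 * (1 + v ^ 2)) / 2) * 1).
    + apply Rmult_le_compat_l; [apply Rlt_le, exp_pos|apply Hv].
    + rewrite Rmult_1_r. apply exp_le. pose proof (pow2_ge_0 v). pose proof (pow2_ge_0 x). nra.
Qed.

Lemma gauss_decay (n : nat) :
  exists C, forall x, 1 <= Rabs x -> Rabs (x ^ n * gauss x) <= C * / Rabs x.
Proof.
  (* From the term of index n + 1 of exp(x^2/2): x^(2n+2) times [gauss x] is at most this constant,
     and |x|^(n+1) <= |x|^(2n+2) because |x| >= 1. *)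
  exists (2 ^ S n * INR (fact (S n))). intros x Hx.
  pose proof (pow_div_fact_le_exp (S n) (x ^ 2 / 2) ltac:(pose proof (pow2_ge_0 x); lra)) as H.
  assert (E : exp (x ^ 2 / 2) = / gauss x).
  { unfold gauss. rewrite <- exp_Ropp. f_equal. field. }
  rewrite E in H. pose proof (gauss_gt0 x) as G.
  rewrite Rabs_mult, <- RPow_abs, (Rabs_pos_eq (gauss x)) by lra.
  rewrite <- pow2_abs in H. set (y := Rabs x) in *.
  unfold Rdiv in H. rewrite Rpow_mult_distr, pow_inv in H.
  assert (H2 : (y ^ 2) ^ S n * gauss x <= 2 ^ S n * INR (fact (S n))).
  { assert (P2 : 0 < 2 ^ S n) by (apply pow_lt; lra).
    apply Rmult_le_reg_l with (/ 2 ^ S n * / gauss x).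
    - apply Rmult_lt_0_compat; now apply Rinv_0_lt_compat.
    - apply Rle_trans with ((y ^ 2) ^ S n * / 2 ^ S n); [right; field; lra|].
      apply Rle_trans with (1 := H). right. field. lra. }
  apply Rmult_le_reg_r with y; [lra|].
  rewrite Rmult_assoc, (Rmult_assoc _ (/ y)), Rinv_l, Rmult_1_r by lra.
  apply Rle_trans with (2 := H2).
  replace (y ^ n * (gauss x * y)) with (y ^ S n * gauss x) by (simpl; ring).
  apply Rmult_le_compat_r; [lra|].
  rewrite <- pow_mult. apply Rle_pow; [exact Hx|lia].
Qed.

(** An arbitrary filter along which |x| diverges treats both infinities at once. *)
Lemma lim_inv_abs (F : (R -> Prop) -> Prop) {FF : Filter F} (f : R -> R) (C : R) :
  filterlim Rabs F (Rbar_locally p_infty) ->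
  (forall x, 1 <= Rabs x -> Rabs (f x) <= C * / Rabs x) ->
  filterlim f F (locally 0).
Proof.
  intros HF H.
  assert (HC : filterlim (fun x => C * / Rabs x) F (locally 0)).
  { apply (filterlim_comp _ _ _ Rabs (fun y => C * / y) _ _ _ HF).
    change (locally 0) with (Rbar_locally 0).
    replace (Finite 0) with (Rbar_mult C (Rbar_inv p_infty)) by (simpl; f_equal; ring).
    apply (is_lim_mult (fun _ => C) (fun y => / y) p_infty).
    - apply is_lim_const.
    - apply is_lim_inv; [apply is_lim_id|easy].
    - exact I. }
  apply (filterlim_le_le (fun x => - (C * / Rabs x)) f (fun x => C * / Rabs x) 0).
  - generalize (HF (fun y => 1 < y) (ex_intro _ _ (fun y H => H))). unfold filtermap.
    apply filter_imp. intros x Hx. apply Rabs_le_between, H. lra.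
  - apply (filterlim_comp _ _ _ _ Ropp _ _ _ HC).
    replace (Rbar_locally 0) with (Rbar_locally (Rbar_opp 0)) by (simpl; now rewrite Ropp_0).
    apply filterlim_Rbar_opp.
  - exact HC.
Qed.

Lemma filterlim_Rabs_p : filterlim Rabs (Rbar_locally p_infty) (Rbar_locally p_infty).
Proof.
  intros P [M HM]. exists M. intros x Hx. apply HM.
  apply Rlt_le_trans with x; [exact Hx|apply Rle_abs].
Qed.

Lemma filterlim_Rabs_m : filterlim Rabs (Rbar_locally m_infty) (Rbar_locally p_infty).
Proof.
  intros P [M HM]. exists (- M). intros x Hx. apply HM.
  apply Rlt_le_trans with (- x); [lra|]. rewrite <- Rabs_Ropp. apply Rle_abs.
Qed.

Lemma gauss_pow_lim (F : (R -> Prop) -> Prop) {FF : Filter F} (n : nat) :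
  filterlim Rabs F (Rbar_locally p_infty) ->
  filterlim (fun x => x ^ n * gauss x) F (locally 0).
Proof.
  intros HF. destruct (gauss_decay n) as [C HC]. now apply lim_inv_abs with C.
Qed.

Lemma gauss_int_lim : filterlim gauss_int (Rbar_locally p_infty) (locally (sqrt (PI / 2))).
Proof.
  apply (filterlim_ext_loc (fun x => sqrt (PI / 2 - 2 * polar_int x))).
  - exists 0. intros x Hx. rewrite <- gauss_int_sqr. apply sqrt_pow2.
    apply RInt_ge_0; [lra|apply ex_RInt_total, gauss_cont|].
    intros y _. apply Rlt_le, gauss_gt0.
  - apply (filterlim_comp _ _ _ (fun x => PI / 2 - 2 * polar_int x) sqrt _ (locally (PI / 2)));
      [|apply continuous_sqrt].
    assert (HP : is_lim polar_int p_infty 0).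
    { apply (is_lim_le_le_loc (fun _ => 0) gauss).
      - exists 0. intros x _. apply polar_int_bounds.
      - apply is_lim_const.
      - pose proof (gauss_pow_lim _ 0 filterlim_Rabs_p) as H. revert H.
        apply filterlim_ext. intros x. simpl. apply Rmult_1_l. }
    pose proof (is_lim_minus' (fun _ => PI / 2) (fun x => 2 * polar_int x) p_infty (PI / 2) (2 * 0)
      (is_lim_const _ _) (is_lim_scal_l polar_int 2 p_infty 0 HP)) as H.
    rewrite Rmult_0_r, Rminus_0_r in H. exact H.
Qed.

Lemma gauss_int_opp (x : R) : gauss_int (- x) = - gauss_int x.
Proof.
  cut (gauss_int (- x) + gauss_int x = gauss_int (- 0) + gauss_int 0).
  { rewrite Ropp_0. unfold gauss_int at 3 4. rewrite RInt_point.
    unfold zero; simpl. lra. }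
  apply (is_derive_eq0_const (fun x => gauss_int (- x) + gauss_int x)).
  intros z. pose proof (is_derive_gauss_int z) as H1. pose proof (is_derive_gauss_int (- z)) as H2.
  auto_derive.
  - split; [eexists; exact H2|]. split; [eexists; exact H1|exact I].
  - rewrite_Derive H1. rewrite_Derive H2.
    unfold gauss. replace ((- z) ^ 2) with (z ^ 2) by ring. ring.
Qed.

(** * The normal density, distribution function and moments *)

Local Notation pdf := std_normal_density.

Lemma pdf_gauss (x : R) : pdf x = gauss x / sqrt (2 * PI).
Proof. reflexivity. Qed.

Lemma sqrt_2PI_gt0 : 0 < sqrt (2 * PI).
Proof. apply sqrt_lt_R0. pose proof PI_RGT_0. lra. Qed.

Lemma sqrt_2PI : sqrt (2 * PI) = 2 * sqrt (PI / 2).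
Proof.
  pose proof PI_RGT_0. rewrite <- (sqrt_pow2 2) at 2 by lra.
  rewrite <- sqrt_mult by lra. f_equal. field.
Qed.

Lemma pdf_gt0 (x : R) : 0 < pdf x.
Proof. apply Rdiv_lt_0_compat; [apply gauss_gt0|apply sqrt_2PI_gt0]. Qed.

Lemma is_derive_pdf (x : R) : is_derive pdf x (- x * pdf x).
Proof.
  pose proof sqrt_2PI_gt0.
  apply (is_derive_ext (fun x => / sqrt (2 * PI) * gauss x)).
  - intros z. rewrite pdf_gauss. real_eq. unfold Rdiv. ring.
  - replace (- x * pdf x) with (/ sqrt (2 * PI) * (- x * gauss x))
      by (rewrite pdf_gauss; unfold Rdiv; ring).
    apply (is_derive_scal gauss), is_derive_gauss.
Qed.

Lemma pdf_cont (x : R) : continuous pdf x.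
Proof. eapply is_derive_continuous, is_derive_pdf. Qed.

Lemma pdf_opp (x : R) : pdf (- x) = pdf x.
Proof. unfold pdf. do 4 f_equal. ring. Qed.

Lemma pdf_le_1 (x : R) : pdf x <= 1.
Proof.
  pose proof sqrt_2PI_gt0 as H.
  assert (H1 : 1 <= sqrt (2 * PI)).
  { rewrite <- sqrt_1. pose proof PI2_1. apply sqrt_le_1; lra. }
  assert (H2 : gauss x <= 1).
  { rewrite <- exp_0. apply exp_le. pose proof (pow2_ge_0 x). lra. }
  rewrite pdf_gauss. apply Rmult_le_reg_r with (sqrt (2 * PI)); [exact H|].
  unfold Rdiv. rewrite Rmult_assoc, Rinv_l by lra. lra.
Qed.

Lemma pdf_pow_lim (F : (R -> Prop) -> Prop) {FF : Filter F} (n : nat) :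
  filterlim Rabs F (Rbar_locally p_infty) ->
  filterlim (fun x => x ^ n * pdf x) F (locally 0).
Proof.
  intros HF. destruct (gauss_decay n) as [C HC].
  apply lim_inv_abs with (C * / sqrt (2 * PI)); [exact FF|exact HF|].
  intros x Hx. specialize (HC x Hx). rewrite pdf_gauss. unfold Rdiv.
  pose proof (Rinv_0_lt_compat _ sqrt_2PI_gt0).
  rewrite <- Rmult_assoc, Rabs_mult, (Rabs_pos_eq (/ sqrt _)) by lra.
  replace (C * / sqrt (2 * PI) * / Rabs x) with (C * / Rabs x * / sqrt (2 * PI)) by ring.
  apply Rmult_le_compat_r; lra.
Qed.

(** A primitive of the density anchored at 0, where symmetry forces the value 1/2. It allows
    ordinary calculus in place of an improper integral. *)
Definition cdf (x : R) : R := 1 / 2 + gauss_int x / sqrt (2 * PI).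

Lemma is_derive_cdf (x : R) : is_derive cdf x (pdf x).
Proof.
  pose proof (is_derive_gauss_int x) as H. unfold cdf. auto_derive.
  - eexists; exact H.
  - rewrite_Derive H. rewrite pdf_gauss. unfold Rdiv. ring.
Qed.

Lemma cdf_opp (x : R) : cdf (- x) = 1 - cdf x.
Proof. unfold cdf. rewrite gauss_int_opp. unfold Rdiv. lra. Qed.

Lemma cdf_lim_p : filterlim cdf (Rbar_locally p_infty) (locally 1).
Proof.
  assert (Hs : 0 < sqrt (PI / 2)) by (apply sqrt_lt_R0; pose proof PI_RGT_0; lra).
  replace 1 with (1 / 2 + sqrt (PI / 2) / sqrt (2 * PI)) by (rewrite sqrt_2PI; field; lra).
  apply (is_lim_plus' (fun _ => 1 / 2) (fun x => gauss_int x / sqrt (2 * PI)) p_infty).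
  - apply is_lim_const.
  - apply (is_lim_scal_r gauss_int (/ sqrt (2 * PI)) p_infty (sqrt (PI / 2)) gauss_int_lim).
Qed.

Lemma cdf_lim_m : filterlim cdf (Rbar_locally m_infty) (locally 0).
Proof.
  apply (filterlim_ext (fun x => 1 - cdf (- x))).
  - intros x. rewrite cdf_opp. ring.
  - replace 0 with (1 - 1) by ring.
    apply (is_lim_minus' (fun _ => 1) (fun x => cdf (- x)) m_infty).
    + apply is_lim_const.
    + apply (filterlim_comp _ _ _ Ropp cdf _ (Rbar_locally p_infty)); [|apply cdf_lim_p].
      apply (filterlim_Rbar_opp m_infty).
Qed.

Lemma is_RInt_gen_primitive (Fa Fb : (R -> Prop) -> Prop) {FFa : Filter Fa} {FFb : Filter Fb}
    (G g : R -> R) (la lb : R) :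
  (forall x, is_derive G x (g x)) -> (forall x, continuous g x) ->
  filterlim G Fa (locally la) -> filterlim G Fb (locally lb) ->
  is_RInt_gen g Fa Fb (lb - la).
Proof.
  intros HG Hg Ha Hb.
  apply (is_RInt_gen_ext (Derive G)).
  - apply filter_forall. intros ab x _. apply is_derive_unique, HG.
  - apply is_RInt_gen_Derive; [| |exact Ha|exact Hb]; apply filter_forall; intros ab x _.
    + now exists (g x).
    + apply (continuous_ext g); [intros y; symmetry; apply is_derive_unique, HG|apply Hg].
Qed.

Lemma std_normal_cdf_eq (x : R) : std_normal_cdf x = cdf x.
Proof.
  apply is_RInt_gen_unique.
  replace (cdf x) with (cdf x - 0) by ring.
  apply (is_RInt_gen_primitive _ _ cdf).
  - apply is_derive_cdf.
  - apply pdf_cont.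
  - apply cdf_lim_m.
  - intros P HP. exact (locally_singleton (cdf x) P HP).
Qed.

(** The values are (n - 1)!! for even n and 0 for odd n. The recursion is both integration by parts
    against the density and the limit of [khin_moment_rec]. *)
Fixpoint normal_moment (n : nat) : R :=
  match n with
  | O => 1
  | S O => 0
  | S (S m as n') => INR n' * normal_moment m
  end.

(** Consecutive exponents go together because the recursion steps by two. *)
Lemma is_RInt_gen_normal_moment (n : nat) :
  is_RInt_gen (fun u => u ^ n * pdf u) (Rbar_locally m_infty) (Rbar_locally p_infty)
    (normal_moment n) /\
  is_RInt_gen (fun u => u ^ S n * pdf u) (Rbar_locally m_infty) (Rbar_locally p_infty)
    (normal_moment (S n)).
Proof.
  assert (Hc : forall k x, continuous (fun u => u ^ k * pdf u) x).
  { intros k x. pose proof (is_derive_pdf x) as H.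
    eapply is_derive_continuous. auto_derive; [|reflexivity].
    eexists; exact H. }
  assert (Hlim : forall k F, Filter F -> filterlim Rabs F (Rbar_locally p_infty) ->
            filterlim (fun u => - (u ^ k * pdf u)) F (locally 0)).
  { intros k F FF HF. replace 0 with (- 0) by ring.
    apply (filterlim_comp _ _ _ _ Ropp _ _ _ (pdf_pow_lim F k HF)).
    apply (filterlim_Rbar_opp 0). }
  assert (Hd : forall k x, is_derive (fun u => - (u ^ k * pdf u)) x
                 (x ^ S k * pdf x - INR k * x ^ pred k * pdf x)).
  { intros k x. pose proof (is_derive_pdf x) as H. auto_derive.
    - eexists; exact H.
    - rewrite_Derive H. simpl. ring. }
  (* Integration by parts: the integrand is the derivative of [- (u ^ k * pdf u)], which vanishes at
     both ends. For k = 0 the value of [pred 0] is harmless, as the factor [INR 0] removes that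
     term. *)
  assert (Hparts : forall k, is_RInt_gen (fun x => x ^ S k * pdf x - INR k * x ^ pred k * pdf x)
            (Rbar_locally m_infty) (Rbar_locally p_infty) (0 - 0)).
  { intros k. apply (is_RInt_gen_primitive _ _ (fun u => - (u ^ k * pdf u))).
    - apply Hd.
    - intros x.
      apply (continuous_minus (fun x => x ^ S k * pdf x) (fun x => INR k * x ^ pred k * pdf x)).
      + apply Hc.
      + apply (continuous_ext (fun x => INR k * (x ^ pred k * pdf x))).
        * intros y. real_eq. ring.
        * apply (continuous_scal_r (INR k) (fun x => x ^ pred k * pdf x)), Hc.
    - apply Hlim; [apply Rbar_locally_filter|apply filterlim_Rabs_m].
    - apply Hlim; [apply Rbar_locally_filter|apply filterlim_Rabs_p]. }
  induction n as [|n [IH0 IH1]]; split.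
  - simpl normal_moment. replace 1 with (1 - 0) by ring.
    apply (is_RInt_gen_primitive _ _ cdf); [|apply Hc|apply cdf_lim_m|apply cdf_lim_p].
    intros x. simpl. rewrite Rmult_1_l. apply is_derive_cdf.
  - specialize (Hparts 0%nat). simpl normal_moment.
    rewrite Rminus_0_r in Hparts. revert Hparts. apply is_RInt_gen_ext.
    apply filter_forall. intros ab x _. simpl. ring.
  - exact IH1.
  - pose proof (is_RInt_gen_plus _ _ _ _ (Hparts (S n)) (is_RInt_gen_scal _ (INR (S n)) _ IH0)) as H.
    replace (normal_moment (S (S n))) with
      (plus (0 - 0) (scal (INR (S n)) (normal_moment n))).
    2:{ change (normal_moment (S (S n))) with (INR (S n) * normal_moment n).
        unfold plus, scal; simpl plus; unfold mult; cbn -[INR]. real_eq. ring. }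
    revert H. apply is_RInt_gen_ext. apply filter_forall. intros ab x _.
    unfold plus, scal; simpl plus; unfold mult; cbn -[INR]. real_eq. ring.
Qed.

Lemma std_normal_moment_eq (n : nat) : std_normal_moment n = normal_moment n.
Proof.
  apply is_RInt_gen_unique. exact (proj1 (is_RInt_gen_normal_moment n)).
Qed.

(** * Solution of Stein's equation *)

Lemma ge0_of_increasing_from_m_infty (f df : R -> R) (w : R) :
  w < 0 -> (forall z, z < 0 -> is_derive f z (df z)) -> (forall z, z < 0 -> 0 <= df z) ->
  filterlim f (Rbar_locally m_infty) (locally 0) -> 0 <= f w.
Proof.
  intros Hw Hd Hpos Hlim.
  apply (filterlim_le (F := Rbar_locally m_infty) f (fun _ => f w) 0 (f w)).
  - exists w. intros z Hz. cut (0 * (w - z) <= f w - f z); [lra|].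
    apply mvt_ge with df; [lra| |]; intros y Hy; [apply Hd|apply Hpos]; lra.
  - exact Hlim.
  - apply filterlim_const.
Qed.

Lemma cdf_ge0 (w : R) : 0 <= cdf w.
Proof.
  apply (filterlim_le (F := Rbar_locally m_infty) cdf (fun _ => cdf w) 0 (cdf w)).
  - exists w. intros z Hz. cut (0 * (w - z) <= cdf w - cdf z); [lra|].
    apply mvt_ge with pdf; [lra| |]; intros y _; [apply is_derive_cdf|apply Rlt_le, pdf_gt0].
  - apply cdf_lim_m.
  - apply filterlim_const.
Qed.

Lemma cdf_le1 (w : R) : cdf w <= 1.
Proof. pose proof (cdf_ge0 (- w)). rewrite cdf_opp in H. lra. Qed.

Lemma lim0_of_pdf_bound (f : R -> R) (C : R) :
  (forall w, w <= -1 -> Rabs (f w) <= C * pdf w) ->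
  filterlim f (Rbar_locally m_infty) (locally 0).
Proof.
  intros H.
  assert (H0 : filterlim (fun x => C * pdf x) (Rbar_locally m_infty) (locally 0)).
  { replace 0 with (C * 0) by ring.
    apply (is_lim_scal_l pdf C m_infty 0).
    apply (filterlim_ext (fun x => x ^ 0 * pdf x)); [intros; simpl; real_eq; ring|].
    apply (pdf_pow_lim (Rbar_locally m_infty) 0), filterlim_Rabs_m. }
  apply (filterlim_le_le (fun x => - (C * pdf x)) f (fun x => C * pdf x) 0).
  - exists (-1). intros x Hx. apply Rabs_le_between, H. lra.
  - replace 0 with (- 0) by ring.
    apply (filterlim_comp _ _ _ _ Ropp _ _ _ H0), (filterlim_Rbar_opp 0).
  - exact H0.
Qed.

(** The function -pdf(z)/z - cdf(z) tends to 0 at minus infinity and has derivative pdf(z)/z^2. *)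
Lemma mills_upper (w : R) : w < 0 -> - w * cdf w <= pdf w.
Proof.
  intros Hw.
  cut (0 <= - (pdf w * / w) - cdf w).
  { intros H. apply Rmult_le_reg_r with (/ - w); [apply Rinv_0_lt_compat; lra|].
    replace (- w * cdf w * / - w) with (cdf w) by (field; lra).
    replace (pdf w * / - w) with (- (pdf w * / w)) by (field; lra). lra. }
  apply (ge0_of_increasing_from_m_infty (fun z => - (pdf z * / z) - cdf z)
           (fun z => pdf z / z ^ 2)); [exact Hw| | |].
  - intros z Hz. pose proof (is_derive_pdf z) as Hp. pose proof (is_derive_cdf z) as Hc.
    auto_derive.
    + split; [eexists; exact Hp|]. split; [lra|]. split; [eexists; exact Hc|exact I].
    + rewrite_Derive Hp. rewrite_Derive Hc. field. lra.
  - intros z Hz. apply Rdiv_le_0_compat; [apply Rlt_le, pdf_gt0|apply pow2_gt_0; lra].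
  - replace 0 with (0 - 0) by ring.
    apply (is_lim_minus' (fun z => - (pdf z * / z)) cdf m_infty 0 0); [|apply cdf_lim_m].
    apply lim0_of_pdf_bound with 1. intros z Hz.
    rewrite Rabs_Ropp, Rabs_mult, (Rabs_pos_eq (pdf z)), Rmult_comm by apply Rlt_le, pdf_gt0.
    apply Rmult_le_compat_r; [apply Rlt_le, pdf_gt0|].
    rewrite Rabs_inv, Rabs_left, <- Rinv_1 by lra. apply Rinv_le_contravar; lra.
Qed.

(** The function cdf(z) + z pdf(z)/(1 + z^2) tends to 0 at minus infinity and has derivative 2
    pdf(z)/(1 + z^2)^2. *)
Lemma mills_lower (w : R) : w < 0 -> - w * pdf w <= (1 + w ^ 2) * cdf w.
Proof.
  intros Hw. assert (Hq : forall z, 0 < 1 + z ^ 2) by (intros z; pose proof (pow2_ge_0 z); lra).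
  cut (0 <= cdf w + w * pdf w / (1 + w ^ 2)).
  { intros H. specialize (Hq w).
    apply (Rmult_le_compat_l (1 + w ^ 2)) in H; [|lra].
    replace ((1 + w ^ 2) * (cdf w + w * pdf w / (1 + w ^ 2)))
      with ((1 + w ^ 2) * cdf w + w * pdf w) in H by (field; lra). lra. }
  apply (ge0_of_increasing_from_m_infty (fun z => cdf z + z * pdf z / (1 + z ^ 2))
           (fun z => 2 * pdf z / (1 + z ^ 2) ^ 2)); [exact Hw| | |].
  - intros z Hz. specialize (Hq z).
    pose proof (is_derive_pdf z) as Hp. pose proof (is_derive_cdf z) as Hc.
    auto_derive.
    + split; [eexists; exact Hc|]. split; [eexists; exact Hp|].
      split; [|exact I]. simpl in Hq. lra.
    + rewrite_Derive Hp. rewrite_Derive Hc. simpl in *. field. lra.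
  - intros z _. apply Rdiv_le_0_compat; [|apply pow_lt, Hq].
    pose proof (pdf_gt0 z). lra.
  - replace 0 with (0 + 0) by ring.
    apply (is_lim_plus' cdf (fun z => z * pdf z / (1 + z ^ 2)) m_infty 0 0); [apply cdf_lim_m|].
    apply lim0_of_pdf_bound with 1. intros z Hz.
    pose proof (pdf_gt0 z) as G. specialize (Hq z).
    unfold Rdiv. rewrite !Rabs_mult, (Rabs_pos_eq (pdf z)), (Rabs_pos_eq (/ _))
      by (try apply Rlt_le, Rinv_0_lt_compat; lra).
    replace (Rabs z * pdf z * / (1 + z ^ 2)) with (Rabs z / (1 + z ^ 2) * pdf z)
      by (unfold Rdiv; ring).
    apply Rmult_le_compat_r; [lra|].
    apply Rmult_le_reg_r with (1 + z ^ 2); [exact Hq|].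
    unfold Rdiv. rewrite Rmult_assoc, Rinv_l, Rabs_left by lra. nra.
Qed.

Definition mills (w : R) : R := cdf w / pdf w.

(** Up to a constant factor, the second expression is the second derivative of Stein's solution in a
    tail. [mills_lower] makes it non-negative; [mills_upper] makes 1 + w mills(w) non-negative, so
    for negative w it is at most mills(w). *)
Lemma mills_bounds (w : R) :
  w <= -1 -> 0 <= mills w <= 1 /\ Rabs (mills w + w * (1 + w * mills w)) <= 2.
Proof.
  intros Hw. pose proof (pdf_gt0 w) as G. pose proof (cdf_ge0 w) as C0.
  pose proof (mills_upper w ltac:(lra)) as U. pose proof (mills_lower w ltac:(lra)) as L.
  assert (E : cdf w = mills w * pdf w) by (unfold mills; field; lra).
  rewrite E in U, L, C0.
  assert (M0 : 0 <= mills w) by (apply Rmult_le_reg_r with (pdf w); lra).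
  assert (MU : - w * mills w <= 1) by (apply Rmult_le_reg_r with (pdf w); lra).
  assert (ML : - w <= (1 + w ^ 2) * mills w) by (apply Rmult_le_reg_r with (pdf w); lra).
  assert (M1 : mills w <= 1) by nra.
  split; [lra|]. apply Rabs_le. nra.
Qed.

Lemma bounded_of_tails (f : R -> R) (x y M : R) :
  (forall z, continuous f z) ->
  (forall z, z <= x -> Rabs (f z) <= M) -> (forall z, y <= z -> Rabs (f z) <= M) ->
  exists B, forall z, Rabs (f z) <= B.
Proof.
  intros Hc Hx Hy.
  destruct (Rle_dec x y) as [Hxy|Hxy].
  - destruct (continuity_ab_maj (fun z => Rabs (f z)) x y Hxy) as [m [Hm _]].
    { intros c _. apply (continuity_pt_comp f Rabs).
      - apply continuity_pt_filterlim, Hc.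
      - apply Rcontinuity_abs. }
    exists (Rmax M (Rabs (f m))). intros z.
    destruct (Rle_dec z x) as [Hz|Hz]; [eapply Rle_trans; [now apply Hx|apply Rmax_l]|].
    destruct (Rle_dec y z) as [Hz'|Hz']; [eapply Rle_trans; [now apply Hy|apply Rmax_l]|].
    eapply Rle_trans; [|apply Rmax_r]. apply Hm. lra.
  - exists M. intros z. destruct (Rle_dec z x); [now apply Hx|apply Hy; lra].
Qed.

Lemma const_of_derive0 (f : R -> R) (x y : R) :
  x <= y -> (forall z, x <= z <= y -> is_derive f z 0) -> f y = f x.
Proof.
  intros Hxy H.
  pose proof (mvt_le f (fun _ => 0) x y 0 Hxy H ltac:(intros; lra)).
  pose proof (mvt_ge f (fun _ => 0) x y 0 Hxy H ltac:(intros; lra)). lra.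
Qed.

(** One minus the normalized integral of a continuous bump. C^1 regularity suffices because the
    second derivative of Stein's solution involves h'. *)
Lemma smooth_step (x y : R) :
  x < y -> exists h h1 : R -> R,
    (forall w, is_derive h w (h1 w)) /\ (forall w, continuous h1 w) /\
    (forall w, w <= x -> h w = 1 /\ h1 w = 0) /\ (forall w, y <= w -> h w = 0 /\ h1 w = 0) /\
    (forall w, 0 <= h w <= 1).
Proof.
  intros Hxy.
  set (v := fun w => (w - x) * (y - w)).
  (* The positive part of v, hence supported on [x, y]. *)
  set (K := fun w => (Rabs (v w) + v w) / 2).
  set (J := RInt K x).
  assert (Kc : forall w, continuous K w).
  { intros w. assert (Vc : continuous v w).
    { eapply is_derive_continuous. unfold v. auto_derive; [exact I|reflexivity]. }
    apply (continuous_scal_l (fun w => Rabs (v w) + v w) (/ 2)).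
    apply (continuous_plus (fun w => Rabs (v w)) v); [|exact Vc].
    now apply (continuous_comp v Rabs), continuous_Rabs. }
  assert (K0 : forall w, 0 <= K w).
  { intros w. unfold K. pose proof (Rle_abs (- v w)). rewrite Rabs_Ropp in H. lra. }
  assert (Kz : forall w, w <= x \/ y <= w -> K w = 0).
  { intros w Hw. unfold K. rewrite Rabs_left1; [lra|]. unfold v. nra. }
  assert (Jd : forall w, is_derive J w (K w)) by (intros w; now apply is_derive_primitive).
  assert (Jmono : forall u w, u <= w -> J u <= J w).
  { intros u w Huw. cut (0 * (w - u) <= J w - J u); [lra|]. now apply mvt_ge with K. }
  assert (Jx : J x = 0) by apply (RInt_point x K).
  assert (Jl : forall w, w <= x -> J w = 0).
  { intros w Hw. rewrite <- Jx. symmetry. apply const_of_derive0; [exact Hw|].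
    intros z Hz. rewrite <- (Kz z); [apply Jd|lra]. }
  assert (Jr : forall w, y <= w -> J w = J y).
  { intros w Hw. apply const_of_derive0; [exact Hw|].
    intros z Hz. rewrite <- (Kz z); [apply Jd|lra]. }
  assert (Jy : 0 < J y).
  { apply RInt_gt_0; [exact Hxy| |intros; apply Kc].
    intros w Hw. unfold K. assert (0 < v w) by (unfold v; nra).
    rewrite Rabs_pos_eq; lra. }
  exists (fun w => 1 - J w / J y), (fun w => - (K w / J y)).
  split; [|split; [|split; [|split]]].
  - intros w. pose proof (Jd w) as H. auto_derive; [eexists; exact H|].
    rewrite_Derive H. unfold Rdiv. ring.
  - intros w. apply (continuous_opp (fun w => K w / J y)).
    apply (continuous_scal_l K (/ J y)), Kc.
  - intros w Hw. rewrite Jl, Kz by (lra || now left). split; field; lra.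
  - intros w Hw. rewrite Jr, Kz by (lra || now right). split; field; lra.
  - intros w.
    assert (0 <= J w) by (destruct (Rle_dec x w); [rewrite <- Jx; now apply Jmono|rewrite Jl; lra]).
    assert (J w <= J y) by (destruct (Rle_dec w y); [now apply Jmono|rewrite Jr; lra]).
    assert (0 <= J w / J y) by (apply Rdiv_le_0_compat; lra).
    assert (J w / J y <= 1).
    { apply Rmult_le_reg_r with (J y); [exact Jy|].
      unfold Rdiv. rewrite Rmult_assoc, Rinv_l by lra. lra. }
    lra.
Qed.

(** With the integrating factor pdf, Stein's equation reads (f pdf)' = (h - N) pdf, so f = (H - N
    cdf)/pdf with H a primitive of h pdf. Taking N to be the normal expectation of h makes the
    numerator vanish at both ends, which keeps f bounded. *)
Lemma stein_solution (x y : R) :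
  x < y -> exists (h f f1 f2 : R -> R) (N B D : R),
    (forall w, w <= x -> h w = 1) /\ (forall w, y <= w -> h w = 0) /\ (forall w, 0 <= h w <= 1) /\
    (forall w, is_derive f w (f1 w)) /\ (forall w, is_derive f1 w (f2 w)) /\
    (forall w, Rabs (f w) <= D) /\ (forall w, Rabs (f2 w) <= B) /\
    (forall w, f1 w - w * f w = h w - N) /\ cdf x <= N <= cdf y.
Proof.
  intros Hxy. destruct (smooth_step x y Hxy) as [h [h1 [Hd [Hc1 [Hl [Hr Hh]]]]]].
  assert (Hc : forall w, continuous h w) by (intros w; eapply is_derive_continuous, Hd).
  (* As h is 1 to the left of x, starting from [cdf x] makes H the integral of h pdf from minus
     infinity. *)
  set (H := fun w => cdf x + RInt (fun z => h z * pdf z) x w).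
  assert (HH : forall w, is_derive H w (h w * pdf w)).
  { intros w.
    assert (Hi : is_derive (fun w => RInt (fun z => h z * pdf z) x w) w (h w * pdf w)).
    { apply (is_derive_primitive (fun z => h z * pdf z)).
      intros z. apply (continuous_mult h pdf); [apply Hc|apply pdf_cont]. }
    unfold H. rewrite <- (Rplus_0_l (h w * pdf w)).
    exact (is_derive_plus (fun _ : R => cdf x) _ w 0 _ (is_derive_const (cdf x) w) Hi). }
  assert (Hx : H x = cdf x).
  { unfold H. rewrite (RInt_point x (fun z => h z * pdf z)). unfold zero; simpl. ring. }
  assert (Hdiff : forall w, is_derive (fun w => cdf w - H w) w ((1 - h w) * pdf w)).
  { intros w. replace ((1 - h w) * pdf w) with (pdf w - h w * pdf w) by ring.
    apply (is_derive_minus cdf H); [apply is_derive_cdf|apply HH]. }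
  assert (HL : forall w, w <= x -> H w = cdf w).
  { intros w Hw.
    assert (E : cdf x - H x = cdf w - H w).
    { apply (const_of_derive0 (fun w => cdf w - H w)); [exact Hw|].
      intros z Hz. replace 0 with ((1 - h z) * pdf z); [apply Hdiff|].
      rewrite (proj1 (Hl z ltac:(lra))). ring. }
    lra. }
  (* As h is 0 to the right of y, H has reached its total there. *)
  set (N := H y).
  assert (HR : forall w, y <= w -> H w = N).
  { intros w Hw. apply const_of_derive0; [exact Hw|].
    intros z Hz. replace 0 with (h z * pdf z); [apply HH|].
    rewrite (proj1 (Hr z ltac:(lra))). ring. }
  assert (HN : cdf x <= N <= cdf y).
  { split.
    - rewrite <- Hx. cut (0 * (y - x) <= H y - H x); [unfold N; lra|].
      apply mvt_ge with (fun w => h w * pdf w); [lra|intros; apply HH|].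
      intros z _. apply Rmult_le_pos; [apply Hh|apply Rlt_le, pdf_gt0].
    - cut (0 * (y - x) <= (cdf y - H y) - (cdf x - H x)); [unfold N; lra|].
      apply (mvt_ge (fun w => cdf w - H w) (fun w => (1 - h w) * pdf w)); [lra|intros; apply Hdiff|].
      intros z _. apply Rmult_le_pos; [pose proof (Hh z); lra|apply Rlt_le, pdf_gt0]. }
  pose proof (cdf_ge0 x). pose proof (cdf_le1 y).
  set (f := fun w => (H w - N * cdf w) / pdf w).
  set (f1 := fun w => h w - N + w * f w).
  set (f2 := fun w => h1 w + f w + w * f1 w).
  assert (Df : forall w, is_derive f w (f1 w)).
  { intros w. pose proof (HH w) as D1. pose proof (is_derive_cdf w) as D2.
    pose proof (is_derive_pdf w) as D3. pose proof (pdf_gt0 w) as G.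
    unfold f1, f.
    replace (h w - N + w * ((H w - N * cdf w) / pdf w)) with
      (((h w * pdf w - N * pdf w) * pdf w - (H w - N * cdf w) * (- w * pdf w)) / pdf w ^ 2)
      by (field; lra).
    apply (is_derive_div (fun w => H w - N * cdf w) pdf); [|exact D3|lra].
    apply (is_derive_minus H (fun w => N * cdf w)); [exact D1|].
    now apply (is_derive_scal cdf). }
  assert (Df1 : forall w, is_derive f1 w (f2 w)).
  { intros w. pose proof (Df w) as D1. pose proof (Hd w) as D2. unfold f2, f1.
    auto_derive.
    - split; [eexists; exact D2|]. split; [eexists; exact D1|exact I].
    - rewrite_Derive D1. rewrite_Derive D2. unfold f1. ring. }
  assert (Cf : forall w, continuous f w) by (intros w; eapply is_derive_continuous, Df).
  assert (Cf2 : forall w, continuous f2 w).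
  { intros w. apply (continuous_plus (fun w => h1 w + f w) (fun w => w * f1 w)).
    - now apply (continuous_plus h1 f).
    - apply (continuous_mult (fun w => w) f1); [apply continuous_id|].
      eapply is_derive_continuous, Df1. }
  (* In the tails h is constant and f is a multiple of the Mills ratio, with factor 1 - N on the
     left and N on the right. The cut at -1 serves [mills_bounds]; the compact middle is left to
     continuity. *)
  assert (FL : forall w, w <= Rmin x (-1) -> Rabs (f w) <= 2 /\ Rabs (f2 w) <= 2).
  { intros w Hw. pose proof (Rmin_l x (-1)). pose proof (Rmin_r x (-1)).
    destruct (mills_bounds w ltac:(lra)) as [M1 M2]. pose proof (pdf_gt0 w) as G.
    assert (Ef : f w = (1 - N) * mills w).
    { unfold f, mills. rewrite HL by lra. field. lra. }
    destruct (Hl w ltac:(lra)) as [E1 E2].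
    assert (Ef2 : f2 w = (1 - N) * (mills w + w * (1 + w * mills w))).
    { unfold f2, f1. rewrite E1, E2, Ef. ring. }
    rewrite Ef, Ef2, !Rabs_mult, (Rabs_pos_eq (1 - N)), (Rabs_pos_eq (mills w)) by lra.
    pose proof (Rabs_pos (mills w + w * (1 + w * mills w))). split; nra. }
  assert (FR : forall w, Rmax y 1 <= w -> Rabs (f w) <= 2 /\ Rabs (f2 w) <= 2).
  { intros w Hw. pose proof (Rmax_l y 1). pose proof (Rmax_r y 1).
    destruct (mills_bounds (- w) ltac:(lra)) as [M1 M2]. pose proof (pdf_gt0 w) as G.
    assert (Ef : f w = N * mills (- w)).
    { unfold f, mills. rewrite cdf_opp, pdf_opp, HR by lra. field. lra. }
    destruct (Hr w ltac:(lra)) as [E1 E2].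
    assert (Ef2 : f2 w = N * (mills (- w) + - w * (1 + - w * mills (- w)))).
    { unfold f2, f1. rewrite E1, E2, Ef. ring. }
    rewrite Ef, Ef2, !Rabs_mult, (Rabs_pos_eq N), (Rabs_pos_eq (mills (- w))) by lra.
    pose proof (Rabs_pos (mills (- w) + - w * (1 + - w * mills (- w)))). split; nra. }
  destruct (bounded_of_tails f (Rmin x (-1)) (Rmax y 1) 2 Cf
    (fun w Hw => proj1 (FL w Hw)) (fun w Hw => proj1 (FR w Hw))) as [D HD].
  destruct (bounded_of_tails f2 (Rmin x (-1)) (Rmax y 1) 2 Cf2
    (fun w Hw => proj2 (FL w Hw)) (fun w Hw => proj2 (FR w Hw))) as [B HB].
  exists h, f, f1, f2, N, B, D.
  split; [intros w Hw; now apply Hl|]. split; [intros w Hw; now apply Hr|].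
  do 5 (split; [assumption|]). split; [|exact HN].
  intros w. unfold f1. ring.
Qed.

Lemma cdf_lipschitz (x d : R) : 0 <= d -> cdf (x + d) <= cdf x + d.
Proof.
  intros Hd. cut (cdf (x + d) - cdf x <= 1 * (x + d - x)); [lra|].
  apply mvt_le with pdf; [lra|intros; apply is_derive_cdf|intros; apply pdf_le_1].
Qed.

(** * Limits *)

Lemma filterlim_Rplus {T : Type} {F : (T -> Prop) -> Prop} {FF : Filter F} (f g : T -> R) (l m : R) :
  filterlim f F (locally l) -> filterlim g F (locally m) ->
  filterlim (fun x => f x + g x) F (locally (l + m)).
Proof. intros Hf Hg. exact (filterlim_comp_2 _ _ _ Hf Hg (filterlim_plus l m)). Qed.

Lemma filterlim_Rmult {T : Type} {F : (T -> Prop) -> Prop} {FF : Filter F} (f g : T -> R) (l m : R) :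
  filterlim f F (locally l) -> filterlim g F (locally m) ->
  filterlim (fun x => f x * g x) F (locally (l * m)).
Proof. intros Hf Hg. exact (filterlim_comp_2 _ _ _ Hf Hg (filterlim_mult l m)). Qed.

Lemma filterlim_sum_f_R0 {T : Type} {F : (T -> Prop) -> Prop} {FF : Filter F}
    (u : nat -> T -> R) (l : nat -> R) (j : nat) :
  (forall i, (i <= j)%nat -> filterlim (u i) F (locally (l i))) ->
  filterlim (fun x => sum_f_R0 (fun i => u i x) j) F (locally (sum_f_R0 l j)).
Proof.
  induction j as [|j IH]; intros H; simpl.
  - now apply H.
  - apply filterlim_Rplus; auto.
Qed.

Lemma binomial_C_pred (j : nat) : Binomial.C (S j) j = INR (S j).
Proof.
  unfold Binomial.C. replace (S j - j)%nat with 1%nat by lia.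
  rewrite fact_simpl, mult_INR. simpl (fact 1). simpl (INR 1). field. apply INR_fact_neq_0.
Qed.

Section Limits.

Variables b a : nat -> R.
Hypothesis b_ge0 : forall n, 0 <= b n.
Hypothesis b_nonconstant : exists n, (1 <= n)%nat /\ 0 < b n.
Hypothesis radius_gt0 : Rbar_lt 0 (CV_radius b).
Hypothesis a_exp : forall t, 0 <= t -> Rbar_lt t (CV_radius b) ->
  is_pseries a t (exp (psum b t)).
Hypothesis b_clan : is_clan b.
Hypothesis b_unbounded : filterlim (psum b) (up_to (CV_radius b)) (Rbar_locally p_infty).

Lemma up_to_inside : up_to (CV_radius b) (fun t => 0 < t /\ Rbar_lt t (CV_radius b)).
Proof.
  apply up_to_exists; [exact radius_gt0|].
  destruct (clan_second_moment b b_ge0 b_nonconstant radius_gt0 b_clan) as [t0 [H0 [H1 _]]].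
  exists t0. split; [exact H0|split; [exact H1|]]. intros t Ht Hr. split; [lra|exact Hr].
Qed.

Lemma khin_moment_lim (n : nat) :
  filterlim (fun t => khin_moment a t n) (up_to (CV_radius b)) (locally (normal_moment n)).
Proof.
  pose proof (up_to_filter _ radius_gt0) as FF.
  induction n as [n IH] using (well_founded_induction Wf_nat.lt_wf).
  destruct n as [|[|j]].
  - apply (filterlim_ext_loc (fun _ => 1)); [|apply filterlim_const].
    apply (filter_imp _ _) with (2 := up_to_inside). intros t [H0 H1].
    symmetry. now apply (khin_moment_0 b a).
  - apply (filterlim_ext_loc (fun _ => 0)); [|apply filterlim_const].
    apply (filter_imp _ _) with (2 := up_to_inside). intros t [H0 H1].
    symmetry. now apply (khin_moment_1 b a).
  - apply (filterlim_ext_loc (fun t =>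
      sum_f_R0 (fun i => Binomial.C (S j) i * khin_moment a t i * ncumulant b (S (S j) - i) t) j)).
    { apply (filter_imp _ _) with (2 := up_to_inside). intros t [H0 H1].
      symmetry. now apply (khin_moment_rec b a). }
    (* In the limit only the cumulant of order 2, at i = j, survives, with value 1; all i < j have
       order at least 3. *)
    set (l := fun i => Binomial.C (S j) i * normal_moment i * (if Nat.eqb i j then 1 else 0)).
    replace (normal_moment (S (S j))) with (sum_f_R0 l j).
    + apply (filterlim_sum_f_R0
        (fun i t => Binomial.C (S j) i * khin_moment a t i * ncumulant b (S (S j) - i) t)).
      intros i Hi. apply filterlim_Rmult.
      * apply filterlim_Rmult; [apply filterlim_const|apply IH; lia].
      * destruct (Nat.eqb_spec i j) as [->|Hij].
        -- replace (S (S j) - j)%nat with 2%nat by lia.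
           apply (filterlim_ext_loc (fun _ => 1)); [|apply filterlim_const].
           apply (filter_imp _ _) with (2 := up_to_inside). intros t [H0 H1].
           symmetry. now apply ncumulant_2.
        -- apply ncumulant_lim; auto. lia.
    + change (normal_moment (S (S j))) with (INR (S j) * normal_moment j).
      assert (Hl : l j = INR (S j) * normal_moment j).
      { unfold l. rewrite Nat.eqb_refl, binomial_C_pred. ring. }
      rewrite <- Hl. destruct j as [|j]; [reflexivity|].
      rewrite tech5, sum_eq_R0; [ring|].
      intros i Hi. unfold l. destruct (Nat.eqb_spec i (S j)); [lia|ring].
Qed.

(** Stein's equation rewrites E[h(W)] - N as E[f'(W) - W f(W)], the quantity that [stein_bound]
    controls. *)
Lemma smooth_expectation (t : R) (h f f1 f2 : R -> R) (N B D : R) :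
  0 < t -> Rbar_lt t (CV_radius b) ->
  (forall w, is_derive f w (f1 w)) -> (forall w, is_derive f1 w (f2 w)) ->
  (forall w, Rabs (f w) <= D) -> (forall w, Rabs (f2 w) <= B) ->
  (forall w, f1 w - w * f w = h w - N) ->
  exists e, is_series (fun n => h (normalized a t n) * khin_prob a t n) e /\
            Rabs (e - N) <= B * ncumulant b 3 t.
Proof.
  intros Ht Hr Hf Hf1 HD HB HN.
  destruct (stein_bound b a b_ge0 b_nonconstant radius_gt0 a_exp b_unbounded t Ht Hr
              f f1 f2 B D Hf Hf1 HD HB) as [Hex Hle].
  apply Series_correct in Hex.
  set (S := Series (fun n => (normalized a t n * f (normalized a t n) - f1 (normalized a t n))
                             * khin_prob a t n)) in *.
  exists (N * 1 - S). split.
  - pose proof (khin_prob_total b a a_exp t Ht Hr) as HP.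
    generalize (is_series_Rminus _ _ _ _ (is_series_Rmult N _ _ HP) Hex).
    apply is_series_ext. intros n. real_eq. specialize (HN (normalized a t n)).
    replace (h (normalized a t n)) with
      (f1 (normalized a t n) - normalized a t n * f (normalized a t n) + N) by lra.
    ring.
  - replace (N * 1 - S - N) with (- S) by ring. now rewrite Rabs_Ropp.
Qed.

Lemma is_series_khin_cdf (t x : R) :
  0 < t -> Rbar_lt t (CV_radius b) ->
  is_series (fun n => if Rle_dec (normalized a t n) x then khin_prob a t n else 0) (khin_cdf a t x).
Proof.
  intros Ht Hr. apply Series_correct.
  apply (ex_series_le (fun n => if Rle_dec (normalized a t n) x then khin_prob a t n else 0)
           (khin_prob a t)).
  - intros n. pose proof (khin_prob_ge0 b a b_ge0 radius_gt0 a_exp b_unbounded t Ht Hr n) as HP.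
    change (Rabs (if Rle_dec (normalized a t n) x then khin_prob a t n else 0) <= khin_prob a t n).
    destruct (Rle_dec _ _); [rewrite Rabs_pos_eq; lra|now rewrite Rabs_R0].
  - exists 1. now apply (khin_prob_total b a).
Qed.

Lemma exp_clan_gaussian : is_gaussian a.
Proof.
  intros x. rewrite std_normal_cdf_eq.
  rewrite (CV_radius_exp b a radius_gt0 a_exp b_unbounded).
  pose proof (up_to_filter _ radius_gt0) as FF.
  apply filterlim_locally. intros eps.
  (* Half of eps pays for the displacement of x in the Lipschitz function [cdf], half for Stein's
     error. The indicator of w <= x lies between the smooth steps on [x - d, x] and [x, x + d]. *)
  set (d := eps / 2). assert (Hd : 0 < d) by (unfold d; pose proof (cond_pos eps); lra).
  destruct (stein_solution x (x + d) ltac:(lra))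
    as (h & f & f1 & f2 & N & B & D & Hl & Hr & Hh & Hf & Hf1 & HD & HB & HN & HNb).
  destruct (stein_solution (x - d) x ltac:(lra))
    as (h' & f' & f1' & f2' & N' & B' & D' & Hl' & Hr' & Hh' & Hf' & Hf1' & HD' & HB' & HN' & HNb').
  assert (B0 : 0 <= B) by (apply Rle_trans with (2 := HB 0), Rabs_pos).
  assert (B0' : 0 <= B') by (apply Rle_trans with (2 := HB' 0), Rabs_pos).
  (* The summand 1 keeps the denominator positive when both B and B' are zero. *)
  assert (Hr0 : 0 < d / (B + B' + 1)) by (apply Rdiv_lt_0_compat; lra).
  pose proof (ncumulant_lim b b_ge0 b_nonconstant radius_gt0 b_clan b_unbounded 3 (le_n 3)
    _ (locally_ball 0 (mkposreal _ Hr0))) as HK. unfold filtermap in HK.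
  generalize (filter_and _ _ up_to_inside HK). apply filter_imp. clear HK.
  intros t [[H0 H1] HK].
  unfold ball in HK; simpl in HK; unfold AbsRing_ball, abs, minus, plus, opp in HK; simpl in HK.
  rewrite Ropp_0, Rplus_0_r in HK.
  assert (HK' : Rabs (ncumulant b 3 t) * (B + B' + 1) < d).
  { apply (Rmult_lt_compat_r (B + B' + 1)) in HK; [|lra].
    unfold Rdiv in HK. rewrite (Rmult_assoc d), Rinv_l in HK by lra. lra. }
  pose proof (Rle_abs (ncumulant b 3 t)) as HA. pose proof (Rabs_pos (ncumulant b 3 t)) as HA0.
  destruct (smooth_expectation t h f f1 f2 N B D H0 H1 Hf Hf1 HD HB HN) as [e [He Hle]].
  destruct (smooth_expectation t h' f' f1' f2' N' B' D' H0 H1 Hf' Hf1' HD' HB' HN')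
    as [e' [He' Hle']].
  pose proof (is_series_khin_cdf t x H0 H1) as HC.
  pose proof (khin_prob_ge0 b a b_ge0 radius_gt0 a_exp b_unbounded t H0 H1) as HP.
  assert (U : khin_cdf a t x <= e).
  { apply (is_series_le _ _ _ _) with (2 := HC) (3 := He). intros n. specialize (HP n).
    destruct (Rle_dec _ _) as [Hw|Hw].
    - rewrite Hl by exact Hw. lra.
    - apply Rmult_le_pos; [apply Hh|exact HP]. }
  assert (L : e' <= khin_cdf a t x).
  { apply (is_series_le _ _ _ _) with (2 := He') (3 := HC). intros n. specialize (HP n).
    destruct (Rle_dec _ _) as [Hw|Hw].
    - pose proof (Hh' (normalized a t n)). nra.
    - rewrite Hr' by lra. lra. }
  pose proof (cdf_lipschitz x d ltac:(lra)) as C1.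
  pose proof (cdf_lipschitz (x - d) d ltac:(lra)) as C2.
  replace (x - d + d) with x in C2 by ring.
  apply Rabs_le_between in Hle. apply Rabs_le_between in Hle'.
  assert (B * ncumulant b 3 t <= B * Rabs (ncumulant b 3 t)) by now apply Rmult_le_compat_l.
  assert (B' * ncumulant b 3 t <= B' * Rabs (ncumulant b 3 t)) by now apply Rmult_le_compat_l.
  assert (0 <= B * Rabs (ncumulant b 3 t)) by now apply Rmult_le_pos.
  assert (0 <= B' * Rabs (ncumulant b 3 t)) by now apply Rmult_le_pos.
  change (Rabs (khin_cdf a t x + - cdf x) < eps).
  replace (pos eps) with (d + d) by (unfold d; field).
  apply Rabs_def1; lra.
Qed.

End Limits.

Theorem theorem4p13 (b a : nat -> R) :
  (* g = sum b_n z^n : non-negative coefficients, non-constant, radius R > 0 *)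
  (forall n, 0 <= b n) ->
  (exists n, (1 <= n)%nat /\ 0 < b n) ->
  Rbar_lt (Finite 0) (CV_radius b) ->
  (* f = e^g = sum a_n z^n *)
  (forall t, 0 <= t -> Rbar_lt (Finite t) (CV_radius b) ->
     is_pseries a t (exp (psum b t))) ->
  (* g is a clan, and g(t) -> +oo as t -> R^- *)
  is_clan b ->
  filterlim (psum b) (up_to (CV_radius b)) (Rbar_locally p_infty) ->
  (forall k : nat, (3 <= k)%nat ->
     filterlim (fun s => Derive_n (fulcrum b) k s
                         / Rpower (Derive_n (fulcrum b) 2 s) (INR k / 2))
               (up_to_ln (CV_radius b)) (locally 0))
  /\
  (forall m : nat, (1 <= m)%nat ->
     filterlim (fun t => khin_moment a t m) (up_to (CV_radius b))
               (locally (std_normal_moment m)))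
  /\
  is_gaussian a.
Proof.
  intros Hb Hn Hr Ha Hc Hu. split; [|split].
  - intros k Hk. now apply fulcrum_cumulant_lim.
  - intros m _. rewrite std_normal_moment_eq. now apply khin_moment_lim.
  - now apply (exp_clan_gaussian b).
Qed.
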